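(* Let $n\ge 2$ be an integer, let $T>0$, and let $I=[0,T]$. A function $f\in\mathcal{L}_n$ is an extreme point of the convex set $\mathcal{L}_n$ if and only if the following two conditions both hold: (i) the sum of the multiplicities of the elements of the closed set $F=\{t\in I : |f(t)|=1\}$ is greater than or equal to $n$; (ii) $|f^{(n)}(t)|=1$ for almost every $t\in I\setminus F$.
   Context: For $n\ge 2$ and $I=[0,T]$, $V_n(I)$ denotes the real vector space of functions $f:I\to\mathbb{R}$ that are $(n-1)$ times differentiable on $I$ (one-sided derivatives at the endpoints) and whose derivative $f^{(n-1)}$ is absolutely continuous on $I$; then $f^{(n)}$ exists almost everywhere. $\mathcal{L}_n=\mathcal{L}_n(T)$ is the set of $f\in V_n(I)$ such that $|f(t)|\le 1$ for all $t\in I$ and $|f^{(n)}(t)|\le 1$ for almost every $t\in I$ (equivalently, $|f|\le 1$ and $f^{(n-1)}$ is $1$-Lipschitz). An extreme point of a convex set $C$ is an $x\in C$ such that for all $y,z\in C$, $2x=y+z$ implies $y=z$. Multiplicity: for $f\in\mathcal{L}_n$ and $t_0\in F$ (that is, $|f(t_0)|=1$), the multiplicity of $t_0$ is the unique integer $m$ such that $1\le m\le n$; $f^{(j)}(t_0)=0$ for all $1\le j\le m-1$; and either $m=n$, or $m<n$ and $f^{(m)}(t_0)\ne 0$. The sum of the multiplicities is $0$ if $F$ is empty and $+\infty$ if $F$ is infinite. *)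

(* Defs.v *)
From HB Require Import structures.
From mathcomp Require Import all_boot all_order all_algebra.
From mathcomp Require Import all_classical all_reals all_analysis.

Set Implicit Arguments.
Unset Strict Implicit.
Unset Printing Implicit Defensive.

Import Order.TTheory GRing.Theory Num.Theory.
Import numFieldNormedType.Exports.

Local Open Scope classical_set_scope.
Local Open Scope ring_scope.

Definition extreme_point (V : zmodType) (C : set V) (x : V) : Prop :=
  C x /\ forall y z : V, C y -> C z -> x *+ 2 = y + z -> y = z.

Section Defs.
Context {R : realType}.
Implicit Types (I : set R) (f : R -> R) (t : R).

(** Derivatives relative to [I]: the increment is restricted to [I], which
    gives the one-sided derivatives at the endpoints of an interval. *)
Definition diff_quotient f t : R -> R := fun s => (f s - f t) / (s - t).

Definition derivable_in I f t : Prop :=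
  cvg (diff_quotient f t @ within I t^').

(** Meaningful at points [t] of [I] where [derivable_in I f t] holds. *)
Definition deriv_in I f : R -> R :=
  fun t => lim (diff_quotient f t @ within I t^').

Definition derivn_in I (k : nat) f : R -> R := iter k (deriv_in I) f.

Definition abs_continuous_on I f : Prop :=
  forall e : R, 0 < e -> exists2 d : R, 0 < d &
    forall (m : nat) (a b : 'I_m -> R),
      (forall i, [/\ a i <= b i, I (a i) & I (b i)]) ->
      trivIset setT (fun i => `]a i, b i[%classic) ->
      \sum_(i < m) (b i - a i) < d ->
      \sum_(i < m) `|f (b i) - f (a i)| < e.

(** A function [I -> R] is encoded by its extension by [0] to the whole line,
    so that [V_space] and [L_class] are subsets of the vector space [R -> R]
    and equality of their elements is equality on [I]. *)
Definition V_space I (n : nat) : set (R -> R) :=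
  [set f | [/\ forall t, ~ I t -> f t = 0,
               forall k t, (k < n.-1)%N -> I t ->
                 derivable_in I (derivn_in I k f) t
             & abs_continuous_on I (derivn_in I n.-1 f)]].

Definition L_class (n : nat) (T : R) : set (R -> R) :=
  let I := `[0, T]%classic in
  [set f | [/\ V_space I n f,
               forall t, I t -> `|f t| <= 1
             & {ae lebesgue_measure, forall t, I t ->
                 derivable_in I (derivn_in I n.-1 f) t /\
                 `|derivn_in I n f t| <= 1}]].

Definition contact_set (T : R) f : set R :=
  [set t | `[0, T]%classic t /\ `|f t| = 1].

Definition is_multiplicity (n : nat) (T : R) f t (m : nat) : Prop :=
  [/\ (1 <= m <= n)%N,
      forall j, (1 <= j <= m.-1)%N -> derivn_in `[0, T] j f t = 0
    & m = n \/ (m < n)%N /\ derivn_in `[0, T] m f t != 0].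

Definition multiplicity (n : nat) (T : R) f t : nat :=
  xget 0%N [set m | is_multiplicity n T f t m].

Lemma is_multiplicity_uniq n T f t m1 m2 :
  is_multiplicity n T f t m1 -> is_multiplicity n T f t m2 -> m1 = m2.
Proof.
wlog lt12 : m1 m2 / (m1 < m2)%N => [W h1 h2|].
  by case: (ltngtP m1 m2) => // lt; [exact: W | symmetry; exact: W].
move=> [/andP[m1_gt0 m1n] _ h1] [/andP[m2_gt0 m2n] z2 _].
case: h1 => [e1|[_ /eqP[]]]; first by rewrite e1 ltnNge m2n in lt12.
by apply: z2; rewrite m1_gt0 -ltnS prednK.
Qed.

Lemma multiplicityP n T f t : (0 < n)%N ->
  is_multiplicity n T f t (multiplicity n T f t).
Proof.
move=> n_gt0; suff [m mP] : exists m, is_multiplicity n T f t m.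
  exact: (xgetPex 0%N (ex_intro _ m mP)).
pose P m := (0 < m <= n)%N &&
  ((m == n) || (derivn_in `[0, T] m f t != 0)).
have exP : exists m, P m by exists n; rewrite /P n_gt0 leqnn eqxx.
case: (ex_minnP exP) => m /andP[/andP[m_gt0 mn] Pm] minm.
exists m; split; first by rewrite m_gt0.
  move=> j /andP[j_gt0 jm]; have ltjm : (j < m)%N by rewrite -(prednK m_gt0) ltnS.
  apply/eqP; apply: contraTT (ltjm) => nz; rewrite -leqNgt; apply: minm.
  by rewrite /P j_gt0 nz orbT (leq_trans (ltnW ltjm) mn).
case: (eqVneq m n) => [|mNn]; first by left.
by right; move: Pm; rewrite ltn_neqAle mNn mn (negPf mNn).
Qed.

(** The [esum] is [+oo] when the contact set is infinite, as every
    multiplicity is at least [1]. *)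
Definition sum_multiplicities (n : nat) (T : R) f : \bar R :=
  (\esum_(t in contact_set T f) ((multiplicity n T f t)%:R)%:E)%E.

End Defs.

(* Main.v *)
Require Import Defs.
From HB Require Import structures.
From mathcomp Require Import all_boot all_order all_algebra finmap.
From mathcomp Require Import all_classical all_reals all_analysis.
From mathcomp Require Import measurable_realfun ring lra.
Import Order.TTheory GRing.Theory Num.Theory.
Import numFieldNormedType.Exports.
Local Open Scope classical_set_scope.
Local Open Scope ring_scope.

(** Write the gap of [f] for the room [1 - |f|] left by the bound on [f], and
    consider a perturbation [phi] of [f], that is half the difference of two
    functions of the class with midpoint [f]. It satisfies [|f| + |phi| <= 1],
    so it lives in the gap, and likewise [|f^(n)| + |phi^(n)| <= 1] almost
    everywhere. The function [f] is extreme when only [phi = 0] is possible.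

    Sufficiency. By (ii), [phi^(n) = 0] almost everywhere off [F]. On [F] the
    gap is zero, so [phi = 0]; as a function has zero derivative at almost every
    point of its zero set ([ae_deriv_zero]), [phi^(n) = 0] almost everywhere on
    [F] as well. As [phi^(n-1)] is absolutely continuous it is then constant
    ([ac_growth_bound]) and [phi] is a polynomial of degree less than [n]. At a
    contact of multiplicity [m] the gap is [O(|t - t0|^m)]
    ([contact_upper_bound]), so [phi] has there a zero of multiplicity at least
    [m]; by (i) these are at least [n] zeros and [phi = 0].

    Necessity of (i). If the multiplicities add up to less than [n], there are
    finitely many contacts; the polynomial with exactly these zeros has a
    vanishing [n]-th derivative, and a small multiple of it fits into the gap,
    which near a contact of multiplicity [m < n] is at least [c |t - t0|^m]
    ([contact_lower_bound]).

    Necessity of (ii). Otherwise [w = 1 - |f^(n)|] is not almost everywhere zero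
    on some interval ]p, q[ where the gap is bounded below. There is a nonzero
    polynomial [Q] of degree at most [n] such that the [n]-fold primitive of
    the density [w Q] on ]p, q[ vanishes outside ]p, q[ ([bump_exists]: [n]
    linear conditions on [n + 1] coefficients), and a small multiple of this
    primitive is a nonzero perturbation.

    The estimates of functions by their derivatives, everywhere or almost
    everywhere, come from Cousin's lemma ([cousin_additive]); the derivatives of
    the class are handled as towers of functions ([derivs]), so that
    [derivs_derivn_in], [L_class_intro] and [extreme_no_perturbation] are the
    interface with the definitions of the class and of extreme points. *)

(** * Derivatives relative to a set *)

Section WithinDerivative.
Context {R : realType}.
Implicit Types (I : set R) (f g : R -> R) (t l c : R).

(** The limit of the difference quotients with the division cleared: the form
    that can be added, restricted and glued without discussing [s = t]. *)
Definition has_der I f t l : Prop := forall e, 0 < e ->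
  exists2 d, 0 < d & forall s, I s -> `|s - t| < d ->
    `|f s - f t - l * (s - t)| <= e * `|s - t|.

Lemma has_derP I f t l :
  (diff_quotient f t @ within I t^' --> l) <-> has_der I f t l.
Proof.
split=> [/cvgrPdist_le H e e0|H].
  have := H e e0; rewrite !near_withinE /prop_near1 -nbhs_ballE => -[d /= d0 Hd].
  exists d => // s Is std.
  have [->|/eqP st] := eqVneq s t; first by rewrite !subrr mulr0 subrr normr0 mulr0.
  have st0 : s - t != 0 by rewrite subr_eq0; apply/eqP.
  have := Hd s; rewrite /ball/= distrC => /(_ std) /(_ (introN eqP st) Is).
  rewrite /diff_quotient => Hq.
  have -> : f s - f t - l * (s - t) = - (l - (f s - f t) / (s - t)) * (s - t).
    by rewrite opprB mulrBl divfK.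
  by rewrite normrM normrN ler_wpM2r.
apply/cvgrPdist_le => e e0; have [d d0 Hd] := H e e0.
rewrite !near_withinE /prop_near1 -nbhs_ballE; exists d => //= s.
rewrite /ball/= distrC => std st Is.
have st0 : s - t != 0 by rewrite subr_eq0.
have st1 : 0 < `|s - t| by rewrite normr_gt0.
rewrite -(ler_pM2r st1) -normrM /diff_quotient mulrBl divfK// distrC.
exact: Hd.
Qed.

Lemma has_der_ext I f g t l : I t -> (forall s, I s -> f s = g s) ->
  has_der I f t l -> has_der I g t l.
Proof.
move=> It fg H e e0; have [d d0 Hd] := H e e0; exists d => // s Is std.
by rewrite -!fg//; exact: Hd.
Qed.

Lemma has_derS I J f t l : J `<=` I -> has_der I f t l -> has_der J f t l.
Proof.
by move=> JI H e e0; have [d d0 Hd] := H e e0; exists d => // s /JI; exact: Hd.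
Qed.

Lemma has_der_derivable f t : derivable f t 1 -> has_der setT f t (derive1 f t).
Proof.
move=> df; apply/has_derP; apply/cvgrPdist_le => e e0.
move: df => /cvgrPdist_le /(_ e e0).
rewrite !near_withinE /prop_near1 -!nbhs_ballE => -[d /= d0 Hd].
exists d => //= s; rewrite /ball/= => std st _.
have := Hd (s - t); rewrite /ball/= sub0r normrN distrC => /(_ std).
rewrite subr_eq0 => /(_ st).
by rewrite derive1E /derive /= scaler1 subrK /diff_quotient mulrC.
Qed.

Lemma has_der_lin I f g t l c m : has_der I f t l -> has_der I g t m ->
  has_der I (fun s => f s + c * g s) t (l + c * m).
Proof.
move=> H K e e0.
have c0 : 0 < `|c| + 1 by rewrite ltr_wpDl.
have e1 : 0 < e / (`|c| + 1) / 2 by rewrite !divr_gt0.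
have [d d0 Hd] := H _ (divr_gt0 e0 (ltr0n R 2)); have [d' d'0 Kd] := K _ e1.
exists (Num.min d d') => [|s Is]; first by rewrite lt_min d0.
rewrite lt_min => /andP[/Hd-/(_ Is) {}Hd /Kd-/(_ Is) {}Kd].
have -> : f s + c * g s - (f t + c * g t) - (l + c * m) * (s - t) =
  (f s - f t - l * (s - t)) + c * (g s - g t - m * (s - t)) by ring.
apply: (le_trans (ler_normD _ _)); rewrite (splitr e) mulrDl lerD//.
rewrite normrM; apply: (@le_trans _ _ ((`|c| + 1) * (e / (`|c| + 1) / 2 * `|s - t|))).
  by rewrite ler_pM// lerDl.
rewrite le_eqVlt; apply/orP; left; apply/eqP; field.
by rewrite gt_eqF.
Qed.

Lemma has_der_cst I c t : has_der I (fun=> c) t 0.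
Proof.
by move=> e e0; exists 1 => // s _ _; rewrite mul0r subrr subr0 normr0 mulr_ge0// ltW.
Qed.

Lemma has_der_sum I (N : nat) (F : 'I_N -> R -> R) (c l : 'I_N -> R) t :
  (forall i, has_der I (F i) t (l i)) ->
  has_der I (fun s => \sum_(i < N) c i * F i s) t (\sum_(i < N) c i * l i).
Proof.
elim: N F c l => [|N IH] F c l H.
  by rewrite big_ord0; under eq_fun do rewrite big_ord0; exact: has_der_cst.
rewrite big_ord_recr/=; under eq_fun do rewrite big_ord_recr/=.
by apply: has_der_lin => //; apply: IH => i; exact: H.
Qed.

Lemma has_der_horner I (p : {poly R}) t :
  has_der I (fun s => p.[s]) t (p^`()).[t].
Proof.
rewrite [X in has_der _ _ _ X](congr1 (fun h => h t) (derivE p)).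
by apply: (has_derS setT) => //; exact/has_der_derivable/derivable_horner.
Qed.

End WithinDerivative.

Section IntervalDerivative.
Context {R : realType}.
Variable T : R.
Hypothesis T0 : 0 < T.
Local Notation I := (`[0, T]%classic : set R).
Implicit Types (f g : R -> R) (t l c : R).

(** No point of [0, T] is isolated, not even an endpoint, so that one-sided
    limits and hence relative derivatives are unique. *)
Lemma itv_accumulation t d : I t -> 0 < d ->
  exists2 s, I s & s != t /\ `|s - t| < d.
Proof.
rewrite /= in_itv/= => /andP[t0 tT] d0.
have [tT'|tT'] := ltP t T.
  pose s := Num.min T (t + d / 2); have ts : t < s by rewrite lt_min tT' ltrDl divr_gt0.
  have sT : s <= T by rewrite ge_min lexx.
  have sd : s <= t + d / 2 by rewrite ge_min lexx orbT.
  exists s; first by rewrite /= in_itv/=; lra.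
  by split; [rewrite gt_eqF|rewrite gtr0_norm ?subr_gt0//; lra].
pose s := Num.max 0 (t - d / 2); have ts : s < t by rewrite gt_max (lt_le_trans T0)//=; lra.
have s0 : 0 <= s by rewrite le_max lexx.
have sd : t - d / 2 <= s by rewrite le_max lexx orbT.
exists s; first by rewrite /= in_itv/=; lra.
by split; [rewrite lt_eqF|rewrite ltr0_norm ?subr_lt0//; lra].
Qed.

Lemma itv_dnbhs_proper t : I t -> ProperFilter (within I t^').
Proof.
move=> It; apply: Build_ProperFilter_ex => A.
rewrite /within/= /dnbhs /within/= -nbhs_ballE => -[d /= d0 Hd].
have [s Is [st std]] := itv_accumulation t d It d0.
by exists s; apply: Hd => //; rewrite /ball/= distrC.
Qed.

Lemma has_der_deriv_in f t l : I t -> has_der I f t l -> deriv_in I f t = l.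
Proof.
move=> It /has_derP H; have PF := itv_dnbhs_proper t It.
exact: (cvg_lim (@Rhausdorff R) H).
Qed.

Lemma has_der_derivable_in f t l : has_der I f t l -> derivable_in I f t.
Proof. by move=> /has_derP H; apply/cvg_ex; exists l. Qed.

Lemma derivable_in_has_der f t : derivable_in I f t ->
  has_der I f t (deriv_in I f t).
Proof. by move=> H; apply/has_derP. Qed.

(** The successive derivatives are carried as one family of functions: such
    towers add up, shift, and are built from the top by taking primitives, none
    of which is convenient with the iterates of [deriv_in]. *)
Definition derivs (k : nat) (F : nat -> R -> R) : Prop :=
  forall j t, (j < k)%N -> I t -> has_der I (F j) t (F j.+1 t).

Lemma derivs_derivn_in k F f : derivs k F -> (forall t, I t -> f t = F 0%N t) ->
  forall j t, (j <= k)%N -> I t -> derivn_in I j f t = F j t.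
Proof.
move=> dF f0; elim=> [|j IH] t jk It; first exact: f0.
apply: has_der_deriv_in => //; apply: (has_der_ext I (F j)) => //.
  by move=> s Is; rewrite -IH// ltnW.
exact: dF.
Qed.

End IntervalDerivative.

(** * Growth estimates from bounds on the derivative *)

Section AlmostEverywhere.
Context {R : realType}.
Local Notation mu := (@lebesgue_measure R).

Lemma ae_imply (P Q : R -> Prop) : (forall t, P t -> Q t) ->
  {ae mu, forall t, P t} -> {ae mu, forall t, Q t}.
Proof. by move=> PQ; apply: filterS => //; exact: (ae_filter_ringOfSetsType mu). Qed.

Lemma ae_imply2 (P Q S : R -> Prop) : (forall t, P t -> Q t -> S t) ->
  {ae mu, forall t, P t} -> {ae mu, forall t, Q t} -> {ae mu, forall t, S t}.
Proof. by move=> PQS; apply: filterS2 => //; exact: (ae_filter_ringOfSetsType mu). Qed.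

End AlmostEverywhere.

Section Growth.
Context {R : realType}.
Implicit Types (I U : set R) (H : R -> R) (a b c : R).
Local Notation mu := (@lebesgue_measure R).

(** Cousin's lemma in additive form: the supremum of the points [x] such that
    [P a x] can neither fail the property nor be smaller than [b], by
    the local hypothesis there. *)
Lemma cousin_additive (P : R -> R -> Prop) a b : a <= b ->
  (forall x y z, x <= y -> y <= z -> P x y -> P y z -> P x z) ->
  (forall t, a <= t <= b -> exists2 d, 0 < d & forall x y,
      a <= x -> x <= t -> t <= y -> y <= b -> t - d < x -> y < t + d -> P x y) ->
  P a b.
Proof.
move=> ab Padd Ploc; pose S := [set x | a <= x <= b /\ P a x].
have Sa : S a.
  split; first by rewrite lexx.
  have [|d d0] := Ploc a; first by rewrite lexx.
  by apply => //; rewrite ?ltrBlDr ltrDl.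
have Sub : ubound S b by move=> x [/andP[]].
have hS : has_sup S by split; [exists a|exists b].
pose s := sup S.
have as_ : a <= s by apply: sup_upper_bound.
have sb : s <= b by apply: sup_le_ub => //; exists a.
have [|d d0 Pd] := Ploc s; first by rewrite as_.
have [x [/andP[ax xb] Pax] sx] := sup_adherent d0 hS.
have xs : x <= s by apply: sup_upper_bound => //; split=> //; rewrite ax.
have Pas : P a s by apply: (Padd a x s) => //; apply: Pd => //; rewrite ltrDl.
move: sb; rewrite le_eqVlt => /orP[/eqP <-//|sb].
pose y := Num.min b (s + d / 2).
have sy : s < y by rewrite lt_min sb ltrDl divr_gt0.
have yb : y <= b by rewrite ge_min lexx.
have yd : y <= s + d / 2 by rewrite ge_min lexx orbT.
have Psy : P s y.
  by apply: Pd => //; [exact: ltW|rewrite ltrBlDr ltrDl|lra].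
have Say : S y.
  split; first by rewrite (le_trans as_ (ltW sy)).
  by apply: (Padd a s y) => //; exact: ltW.
by have := sup_upper_bound hS Say; rewrite leNgt sy.
Qed.

(** Straddling [t] is what makes the estimate work: the increment from [x] to
    [y] is the sum of two increments based at [t]. *)
Lemma has_der_local_growth I H t l c e : I t -> has_der I H t l -> `|l| <= c -> 0 < e ->
  exists2 d, 0 < d & forall x y, I x -> I y -> x <= t -> t <= y ->
    t - d < x -> y < t + d -> `|H y - H x| <= (c + e) * (y - x).
Proof.
move=> It dH lc e0; have [d d0 Hd] := dH e e0; exists d => // x y Ix Iy xt ty dx dy.
have near_t s : I s -> `|s - t| < d -> `|H s - H t| <= (c + e) * `|s - t|.
  move=> Is std; rewrite -[H s - H t](subrK (l * (s - t))).
  rewrite (le_trans (ler_normD _ _))// addrC mulrDl normrM lerD ?Hd//.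
  by rewrite ler_wpM2r.
rewrite -[H y - H x](subrKA (H t)) (le_trans (ler_normD _ _))//.
have yt : `|y - t| = y - t by rewrite ger0_norm ?subr_ge0.
have tx : `|x - t| = t - x by rewrite distrC ger0_norm ?subr_ge0.
have := near_t y Iy; rewrite yt ltrBlDl => /(_ dy) {}yt.
have := near_t x Ix; rewrite tx distrC ltrBlDl -ltrBlDr => /(_ dx) {}tx.
by rewrite (le_trans (lerD yt tx))// -mulrDr addrA subrK.
Qed.

Lemma growth_bound I H a b c : a <= b -> (forall t, a <= t <= b -> I t) ->
  (forall t, a <= t <= b -> exists2 l, has_der I H t l & `|l| <= c) ->
  `|H b - H a| <= c * (b - a).
Proof.
move=> ab abI dH; apply/ler_addgt0Pr => e e0.
have e1 : 0 < e / (b - a + 1) by rewrite divr_gt0// ltr_wpDl// subr_ge0.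
suff : `|H b - H a| <= (c + e / (b - a + 1)) * (b - a).
  move/le_trans; apply; rewrite mulrDl lerD2l mulrAC ler_pdivrMr.
    by rewrite ler_pM2l// lerDl.
  by rewrite ltr_wpDl// subr_ge0.
apply: (cousin_additive (fun x y => `|H y - H x| <= (c + e / (b - a + 1)) * (y - x))) => //.
  move=> x y z _ _ xy yz; rewrite -[H z - H x](subrKA (H y)).
  rewrite (le_trans (ler_normD _ _))//.
  by rewrite (le_trans (lerD yz xy))// -mulrDr addrA subrK.
move=> t tab; have [l dl lc] := dH t tab.
have [d d0 Hd] := has_der_local_growth I H t l c _ (abI t tab) dl lc e1.
exists d => // x y ax xt ty yb; move: tab => /andP[at_ tb]; apply: Hd => //.
- by apply: abI; rewrite ax (le_trans xt).
- by apply: abI; rewrite yb andbT (le_trans at_).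
Qed.

(** The slope bound [k] is only required up to the increments of [H] over
    finitely many disjoint intervals inside [U]. Carrying the list of intervals,
    rather than the supremum of such sums, keeps the property additive and
    matches the shape of absolute continuity. *)
Definition growth_off H U k x y := exists m (al bl : 'I_m -> R),
  [/\ forall i, [/\ al i <= bl i, x <= al i & bl i <= y],
      trivIset setT (fun i => `]al i, bl i[%classic),
      forall i, `]al i, bl i[%classic `<=` U
    & `|H y - H x| <= k * (y - x) + \sum_(i < m) `|H (bl i) - H (al i)|].

Lemma growth_off_add H U k x y z : x <= y -> y <= z ->
  growth_off H U k x y -> growth_off H U k y z -> growth_off H U k x z.
Proof.
move=> xy yz [m1 [a1 [b1 [ab1 tr1 U1 H1]]]] [m2 [a2 [b2 [ab2 tr2 U2 H2]]]].
exists (m1 + m2)%N.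
exists (fun i => match fintype.split i with inl j => a1 j | inr j => a2 j end).
exists (fun i => match fintype.split i with inl j => b1 j | inr j => b2 j end).
split.
- move=> i; case: (fintype.split i) => j.
    by have [? ? bj] := ab1 j; split => //; exact: le_trans yz.
  by have [? aj ?] := ab2 j; split => //; exact: le_trans aj.
- have sep j1 j2 u : `]a1 j1, b1 j1[%classic u -> `]a2 j2, b2 j2[%classic u -> False.
    have [_ _ bj] := ab1 j1; have [_ aj _] := ab2 j2.
    by rewrite /= !in_itv/= => /andP[_ u1] /andP[u2 _]; lra.
  move=> i j _ _ [u []]; rewrite -(splitK i) -(splitK j) !unsplitK.
  case: (fintype.split i) => i'; case: (fintype.split j) => j' ui uj.
  + by congr (unsplit (inl _)); apply: tr1 => //; exists u.
  + by case: (sep i' j' u).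
  + by case: (sep j' i' u).
  + by congr (unsplit (inr _)); apply: tr2 => //; exists u.
- by move=> i; case: (fintype.split i).
- rewrite big_split_ord/=.
  under [X in _ + (X + _)]eq_bigr do rewrite (unsplitK (inl _)).
  under [X in _ + (_ + X)]eq_bigr do rewrite (unsplitK (inr _)).
  rewrite -[H z - H x](subrKA (H y)) (le_trans (ler_normD _ _))//.
  rewrite (le_trans (lerD H2 H1))// le_eqVlt; apply/orP; left; apply/eqP; ring.
Qed.

Lemma sum_lengths_le (m : nat) (al bl : 'I_m -> R) U : measurable U ->
  (forall i, al i <= bl i) ->
  trivIset setT (fun i => `]al i, bl i[%classic) ->
  (forall i, `]al i, bl i[%classic `<=` U) ->
  ((\sum_(i < m) (bl i - al i))%:E <= mu U)%E.
Proof.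
move=> mU ab tr sU; rewrite -sumEFin.
have -> : (\sum_(i < m) (bl i - al i)%:E = \sum_(i < m) mu `]al i, bl i[%classic)%E.
  apply: eq_bigr => i _; rewrite lebesgue_measure_itv/= lte_fin.
  by case: ltgtP (ab i) => // -> _; rewrite subrr.
rewrite -(@measure_bigsetU_ord _ _ _ mu m xpredT)//.
apply: le_measure; rewrite ?inE//.
  by apply: bigsetU_measurable.
by elim/big_ind: _ => [x []|A B AU BU x [/AU|/BU]|i _] //; exact: sU.
Qed.

(** The exceptional null set is enclosed in an open set so small that absolute
    continuity makes the increments over its subintervals negligible; Cousin's
    lemma glues these increments with those controlled by the derivative. *)
Lemma ac_growth_bound I H a b c : 0 <= c -> a <= b -> (forall t, a <= t <= b -> I t) ->
  abs_continuous_on I H ->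
  {ae mu, forall t, a <= t <= b -> exists2 l, has_der I H t l & `|l| <= c} ->
  `|H b - H a| <= c * (b - a).
Proof.
move=> c0 ab abI acH [N [mN N0 NP]]; apply/ler_addgt0Pr => e e0.
have e2 : 0 < e / 2 by rewrite divr_gt0.
have e1 : 0 < e / 2 / (b - a + 1) by rewrite divr_gt0// ltr_wpDl// subr_ge0.
have [d d0 Hd] := acH _ e2.
have [|U [oU NU muU]] := @lebesgue_regularity_outer R N d mN _ d0.
  by rewrite [X in (X < _)%E]N0 ltry.
have mU : measurable U by exact: open_measurable.
have muU' : (mu U < d%:E)%E.
  apply: le_lt_trans muU.
  have -> : U = (U `\` N) `|` N by rewrite setUC setDUK.
  rewrite (le_trans (measureU2 _ _ _))//; first exact: measurableD.
  rewrite [X in (_ + X)%E]N0 adde0 le_measure ?inE//; first exact: measurableD.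
    by apply: measurableD => //; apply: measurableU => //; exact: measurableD.
  by move=> x [xU xN]; split=> //; left.
suff [m [al [bl [ab_ tr sU Hle]]]] : growth_off H U (c + e / 2 / (b - a + 1)) a b.
  have : \sum_(i < m) `|H (bl i) - H (al i)| < e / 2.
    apply: Hd => //.
      move=> i; have [abi ai bi] := ab_ i; split => //; apply: abI.
        by rewrite ai (le_trans abi).
      by rewrite bi (le_trans ai).
    rewrite -lte_fin; apply: le_lt_trans muU'; apply: sum_lengths_le => // i.
    by have [] := ab_ i.
  have : (e / 2 / (b - a + 1)) * (b - a) <= e / 2.
    rewrite mulrAC ler_pdivrMr ?ltr_wpDl ?subr_ge0//.
    by rewrite ler_pM2l// lerDl.
  move: Hle; rewrite mulrDl; lra.
apply: cousin_additive => //; first by move=> x y z; exact: growth_off_add.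
move=> t tab; case: (pselect (N t)) => Nt.
  have /nbhs_ballP[r /= r0 rU] : nbhs t U by apply: open_nbhs_nbhs; split=> //; exact: NU.
  exists r => // x y ax xt ty yb rx ry.
  exists 1%N, (fun=> x), (fun=> y); split.
  - by move=> _; split => //; exact: le_trans ty.
  - by move=> i j _ _ _; rewrite !ord1.
  - move=> _ s /=; rewrite in_itv/= => /andP[xs sy]; apply: rU.
    by rewrite /ball/= ltr_distl; apply/andP; split; lra.
  - rewrite big_ord1 lerDr mulr_ge0 ?subr_ge0 ?(le_trans xt ty)//.
    by rewrite addr_ge0 ?(ltW e1).
have [l dl lc] : exists2 l, has_der I H t l & `|l| <= c.
  by apply: contrapT => nl; apply: Nt; apply: NP => /(_ tab).
have [r r0 Hr] := has_der_local_growth I H t l c _ (abI t tab) dl lc e1.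
exists r => // x y ax xt ty yb rx ry; move: tab => /andP[at_ tb].
exists 0%N, (fun=> x), (fun=> y); split=> [[]//||[]//|].
  by move=> [].
rewrite big_ord0 addr0; apply: Hr => //.
- by apply: abI; rewrite ax (le_trans xt).
- by apply: abI; rewrite yb andbT (le_trans at_).
Qed.

End Growth.

(** * Lipschitz towers and the class L_n *)

Section Lipschitz.
Context {R : realType}.
Variable T : R.
Hypothesis T0 : 0 < T.
Local Notation I := (`[0, T]%classic : set R).
Local Notation mu := (@lebesgue_measure R).
Implicit Types (f g H : R -> R) (t l c K : R) (F : nat -> R -> R).

Definition lip_on K f := forall s t, I s -> I t -> `|f s - f t| <= K * `|s - t|.

Lemma itv_sub a b t : I a -> I b -> a <= t <= b -> I t.
Proof. by rewrite /= !in_itv/=; lra. Qed.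

Lemma lip_onW c f : (forall s t, I s -> I t -> s <= t -> `|f t - f s| <= c * (t - s)) ->
  lip_on c f.
Proof.
move=> H s t Is It; have [st|/ltW ts] := leP s t.
  by rewrite distrC (distrC s) (@ger0_norm _ (t - s)) ?subr_ge0 ?H.
by rewrite (@ger0_norm _ (s - t)) ?subr_ge0 ?H.
Qed.

Lemma has_der_lip c H : (forall t, I t -> exists2 l, has_der I H t l & `|l| <= c) ->
  lip_on c H.
Proof.
move=> dH; apply: lip_onW => s t Is It st; apply: (growth_bound I) => // u.
  exact: itv_sub.
by move=> /(itv_sub _ _ _ Is It)/dH.
Qed.

(** For absolutely continuous functions a bound on the derivative almost
    everywhere is as good as a bound everywhere; for instance a derivative that
    vanishes almost everywhere forces the function to be constant. *)
Lemma ac_has_der_lip c H : 0 <= c -> abs_continuous_on I H ->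
  {ae mu, forall t, I t -> exists2 l, has_der I H t l & `|l| <= c} -> lip_on c H.
Proof.
move=> c0 acH dH; apply: lip_onW => s t Is It st.
apply: (ac_growth_bound I) => // [u|]; first exact: itv_sub.
by apply: ae_imply dH => u dHu /(itv_sub _ _ _ Is It)/dHu.
Qed.

Lemma lip_bounded K f : lip_on K f -> exists2 C, 0 <= C & forall t, I t -> `|f t| <= C.
Proof.
move=> lf; have I0 : I 0 by rewrite /= in_itv/= lexx ltW.
exists (`|f 0| + `|K| * T).
  by rewrite addr_ge0// mulr_ge0// ltW.
move=> t It; rewrite -[f t](subrK (f 0)) (le_trans (ler_normD _ _))// addrC lerD2l.
apply: le_trans (lf t 0 It I0) _; rewrite subr0.
move: It; rewrite /= in_itv/= => /andP[t0 tT]; rewrite ger0_norm//.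
by rewrite (le_trans (ler_wpM2r t0 (ler_norm K)))// ler_wpM2l.
Qed.

Lemma lip_ac K f : lip_on K f -> abs_continuous_on I f.
Proof.
move=> lf e e0; have K0 : 0 < `|K| + 1 by rewrite ltr_wpDl.
exists (e / (`|K| + 1)); first by rewrite divr_gt0.
move=> m a b abI _; rewrite ltr_pdivlMr// => Hs; apply: le_lt_trans Hs.
rewrite mulr_suml; apply: ler_sum => i _; have [ab Ia Ib] := abI i.
apply: (le_trans (lf _ _ Ib Ia)); rewrite mulrC ger0_norm ?subr_ge0//.
by rewrite ler_wpM2l ?subr_ge0// (le_trans (ler_norm K))// lerDl.
Qed.

(** A Lipschitz function on a bounded interval is bounded, and a function with
    bounded derivative is Lipschitz: the property descends the tower. *)
Lemma derivs_lip k F K : derivs T k F -> lip_on K (F k) ->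
  forall j, (j <= k)%N -> exists2 C, 0 <= C & lip_on C (F j).
Proof.
move=> dF lF.
have step i : (i <= k)%N -> exists2 C, 0 <= C & lip_on C (F (k - i)%N).
  elim: i => [|i IH] ik.
    rewrite subn0; exists `|K| => // s t Is It; apply: le_trans (lF s t Is It) _.
    by rewrite ler_wpM2r// ler_norm.
  have [C C0 lC] := IH (ltnW ik); have [B B0 HB] := lip_bounded _ _ lC.
  exists B => //; apply: has_der_lip => t It; exists (F (k - i)%N t); last exact: HB.
  by rewrite -[in X in has_der _ _ _ X](subnSK ik); apply: dF => //; rewrite subnSK// leq_subr.
by move=> j jk; rewrite -(subKn jk); apply: step; rewrite leq_subr.
Qed.

Lemma derivs_lin k F G c : derivs T k F -> derivs T k G ->
  derivs T k (fun j t => F j t + c * G j t).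
Proof. by move=> dF dG j t jk It; apply: has_der_lin; [exact: dF|exact: dG]. Qed.

Lemma lip_on_lin K L f g c : lip_on K f -> lip_on L g ->
  lip_on (K + `|c| * L) (fun t => f t + c * g t).
Proof.
move=> lf lg s t Is It.
have -> : f s + c * g s - (f t + c * g t) = (f s - f t) + c * (g s - g t) by ring.
rewrite (le_trans (ler_normD _ _))// mulrDl lerD ?lf// normrM -mulrA.
by rewrite ler_wpM2l// lg.
Qed.

End Lipschitz.

Section Class.
Context {R : realType}.
Variables (T : R) (n : nat).
Hypotheses (T0 : 0 < T) (n0 : (0 < n)%N).
Local Notation I := (`[0, T]%classic : set R).
Local Notation mu := (@lebesgue_measure R).
Implicit Types (f g H : R -> R) (t l c K : R) (F : nat -> R -> R).

Lemma derivn_in_pred f : derivn_in I n f = deriv_in I (derivn_in I n.-1 f).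
Proof. by rewrite /derivn_in -[in LHS](prednK n0). Qed.

Lemma L_class_derivs f : L_class n T f -> derivs T n.-1 ((derivn_in I)^~ f).
Proof. by move=> [[_ df _] _ _] j t jn It; apply/derivable_in_has_der/df. Qed.

Lemma L_class_ae f : L_class n T f ->
  {ae mu, forall t, I t -> has_der I (derivn_in I n.-1 f) t (derivn_in I n f t) /\
                           `|derivn_in I n f t| <= 1}.
Proof.
move=> [_ _]; apply: ae_imply => t H /H [dt ->]; split => //.
by rewrite derivn_in_pred; apply/derivable_in_has_der.
Qed.

Lemma L_class_lip f : L_class n T f -> lip_on T 1 (derivn_in I n.-1 f).
Proof.
move=> Lf; have [[_ _ acf] _ _] := Lf; apply: ac_has_der_lip => //.
by apply: ae_imply _ (L_class_ae f Lf) => t H /H[dt dt1]; exists (derivn_in I n f t).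
Qed.

(** Membership in the class is checked on any tower over [f]. The entry [F n]
    only has to be a derivative almost everywhere, whereas the entries below are
    derivatives at every point. *)
Lemma L_class_intro f F K : (forall t, ~ I t -> f t = 0) ->
  (forall t, I t -> f t = F 0%N t) -> derivs T n.-1 F -> lip_on T K (F n.-1) ->
  (forall t, I t -> `|F 0%N t| <= 1) ->
  {ae mu, forall t, I t -> has_der I (F n.-1) t (F n t) /\ `|F n t| <= 1} ->
  L_class n T f.
Proof.
move=> f0 fF dF lF F1 aeF.
have E j t : (j <= n.-1)%N -> I t -> derivn_in I j f t = F j t.
  exact: derivs_derivn_in.
split.
- split => //.
  + move=> k t kn It; apply: has_der_derivable_in.
    apply: (has_der_ext I (F k)) => //; last exact: dF.
    by move=> s Is; rewrite E// ltnW.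
  + move=> e e0; have [d d0 Hd] := lip_ac T K _ lF e e0; exists d => // m a b abI tr sm.
    rewrite (eq_bigr (fun i => `|F n.-1 (b i) - F n.-1 (a i)|)); first exact: Hd.
    by move=> i _; have [_ Ia Ib] := abI i; rewrite !E.
- by move=> t It; rewrite fF// F1.
- apply: ae_imply aeF => t H It; have [dt Ft] := H It.
  have dt' : has_der I (derivn_in I n.-1 f) t (F n t).
    by apply: (has_der_ext I (F n.-1)) => // s Is; rewrite E.
  split; first exact: (has_der_derivable_in _ _ _ _ dt').
  have -> : derivn_in I n f t = F n t.
    by rewrite derivn_in_pred; exact: (has_der_deriv_in T T0 _ _ _ It dt').
  exact: Ft.
Qed.

(** Both [f + F 0] and [f - F 0] belong to the class and [f] is their
    midpoint. All the necessary conditions are obtained by feeding a nonzero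
    perturbation to this lemma. *)
Lemma extreme_no_perturbation f F K : extreme_point (L_class n T) f ->
  derivs T n.-1 F -> lip_on T K (F n.-1) ->
  (forall t, I t -> `|f t| + `|F 0%N t| <= 1) ->
  {ae mu, forall t, I t -> has_der I (F n.-1) t (F n t) /\
                           `|derivn_in I n f t| + `|F n t| <= 1} ->
  forall t, I t -> F 0%N t = 0.
Proof.
move=> [Lf ext] dF lF F1 aeF.
have [[f0 _ _] _ _] := Lf.
pose g c t := if t \in I then f t + c * F 0%N t else 0.
have gL c : `|c| = 1 -> L_class n T (g c).
  move=> c1; apply: (@L_class_intro _ (fun j t => derivn_in I j f t + c * F j t) (1 + `|c| * K)).
  - by move=> t nIt; rewrite /g memNset.
  - by move=> t It; rewrite /g mem_set.
  - by apply: derivs_lin => //; exact: L_class_derivs.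
  - by apply: lip_on_lin => //; exact: L_class_lip.
  - move=> t It; apply: le_trans (F1 t It).
    by rewrite (le_trans (ler_normD _ _))// normrM c1 mul1r.
  - apply: ae_imply2 _ (L_class_ae f Lf) aeF => t H1 H2 It.
    have [d1 _] := H1 It; have [d2 le1] := H2 It; split; first exact: has_der_lin.
    apply: le_trans le1.
    by rewrite (le_trans (ler_normD _ _))// normrM c1 mul1r.
have E : f *+ 2 = g 1 + g (-1).
  apply/funext => t; rewrite mulr2n /g.
  change (f t + f t = (if t \in I then f t + 1 * F 0%N t else 0)
    + (if t \in I then f t + -1 * F 0%N t else 0)).
  case: ifPn => [_|]; first by ring.
  by rewrite notin_setE => /f0->.
have := ext _ _ (gL 1 (normr1 _)) (gL (-1) _) E.
rewrite normrN normr1 => /(_ erefl) /(congr1 (fun h => h _)) Eg t It.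
have := Eg t; rewrite /g mem_set//; lra.
Qed.

End Class.

(** * Taylor estimates at contact points *)

Section Taylor.
Context {R : realType}.
Variable T : R.
Hypothesis T0 : 0 < T.
Local Notation I := (`[0, T]%classic : set R).
Implicit Types (f g H : R -> R) (t l c K : R) (F : nat -> R -> R) (p : {poly R}).

Lemma growth_between H c t0 t : I t0 -> I t ->
  (forall u, I u -> `|u - t0| <= `|t - t0| -> exists2 l, has_der I H u l & `|l| <= c) ->
  `|H t - H t0| <= c * `|t - t0|.
Proof.
move=> It0 It dH; have [tt|/ltW tt] := leP t0 t.
  rewrite (@ger0_norm _ (t - t0)) ?subr_ge0//; apply: (growth_bound I) => // u.
    exact: (itv_sub T).
  move=> ut; apply: dH; first exact: (itv_sub T _ _ _ It0 It).
  by rewrite !ger0_norm; lra.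
rewrite distrC (distrC t) (@ger0_norm _ (t0 - t)) ?subr_ge0//.
apply: (growth_bound I) => // u; first exact: (itv_sub T).
move=> ut; apply: dH; first exact: (itv_sub T _ _ _ It It0).
by rewrite !ler0_norm; lra.
Qed.

(** The estimate for [F 1], which vanishes at [t0], holds with the same constant
    on the whole segment from [t0] to [t], so integrating it gains one more
    factor [`|t - t0|]. *)
Lemma taylor_bound k F K t0 : derivs T k F -> lip_on T K (F k) -> I t0 ->
  (forall j, (0 < j <= k)%N -> F j t0 = 0) ->
  exists2 C, 0 <= C & forall t, I t -> `|F 0%N t - F 0%N t0| <= C * `|t - t0| ^+ k.+1.
Proof.
elim: k F => [|k IH] F dF lF It0 F0.
  exists `|K| => // t It; apply: le_trans (lF t t0 It It0) _.
  by rewrite expr1 ler_wpM2r// ler_norm.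
have [C C0 HC] : exists2 C, 0 <= C & forall t, I t ->
    `|F 1%N t - F 1%N t0| <= C * `|t - t0| ^+ k.+1.
  apply: (IH (fun j => F j.+1)) => //.
    by move=> j t jk It; apply: dF.
  by move=> j /andP[j0 jk]; apply: F0.
exists C => // t It; rewrite exprSr mulrA; apply: growth_between => // u Iu ut.
exists (F 1%N u); first exact: dF.
have := HC u Iu; rewrite (F0 1%N)// subr0 => /le_trans; apply.
by rewrite ler_wpM2l// lerXn2r// ?nnegrE.
Qed.

Lemma derivs_horner p k : derivs T k (fun j t => (p^`(j)).[t]).
Proof. by move=> j t _ _; rewrite derivnS; exact: has_der_horner. Qed.

Lemma lip_horner p : exists2 C, 0 <= C & lip_on T C (horner p).
Proof.
have [|] := derivs_lip T T0 _ _ 0 (derivs_horner p (size p)) _ 0%N isT.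
  by move=> s t _ _; rewrite derivn_poly0// !horner0 subrr normr0 mul0r.
by move=> C C0 lC; exists C.
Qed.

Lemma derivn_XsubC_exp (c : R) (m j : nat) :
  (('X - c%:P) ^+ m)^`(j) = ('X - c%:P) ^+ (m - j) *+ (m ^_ j) :> {poly R}.
Proof.
elim: j => [|j IH]; first by rewrite subn0 ffactn0 mulr1n.
rewrite derivnS IH derivMn deriv_exp derivXsubC mul1r -mulrnA.
by rewrite ffactnSr mulnC subnS.
Qed.

(** After subtracting the leading Taylor term [a (t - t0)^m] all derivatives up
    to order [m] vanish at [t0], so the rest is [O(|t - t0|^(m+1))]. Since
    [|F 0| <= 1], the leading term cannot push [F 0] beyond its value [1] or
    [-1] at [t0]: it has the opposite sign, and half of it survives. *)
Lemma contact_lower_bound k F K (m : nat) t0 : derivs T k F -> lip_on T K (F k) ->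
  (0 < m <= k)%N -> I t0 -> (forall t, I t -> `|F 0%N t| <= 1) -> `|F 0%N t0| = 1 ->
  (forall j, (0 < j < m)%N -> F j t0 = 0) -> F m t0 != 0 ->
  exists2 c, 0 < c & exists2 d, 0 < d & forall t, I t -> `|t - t0| < d ->
    c * `|t - t0| ^+ m <= 1 - `|F 0%N t|.
Proof.
move=> dF lF /andP[m0 mk] It0 F1 Ft0 Fj Fm.
pose a := F m t0 / (m`!)%:R; pose p : {poly R} := a *: ('X - t0%:P) ^+ m.
have fm0 : (m`!)%:R != 0 :> R by rewrite pnatr_eq0 -lt0n fact_gt0.
have a0 : a != 0 by rewrite mulf_neq0// invr_eq0.
pose G j t := F j t + (-1) * (p^`(j)).[t].
have pj j : (j <= m)%N -> (p^`(j)).[t0] = if j == m then F m t0 else 0.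
  move=> jm; rewrite /p derivnZ hornerZ derivn_XsubC_exp hornerMn horner_exp.
  rewrite !hornerE subrr expr0n subn_eq0.
  case: (eqVneq j m) => [->|jm']; first by rewrite leqnn ffactnn divfK.
  by rewrite leqNgt ltn_neqAle jm' jm /= mul0rn mulr0.
have [C C0 lC] := derivs_lip T T0 _ _ _ dF lF _ mk.
have [C' C'0 lC'] := lip_horner (p^`(m)).
have dG : derivs T m G.
  apply: derivs_lin; last exact: derivs_horner.
  by move=> j t jm It; apply: dF => //; exact: leq_trans mk.
have Gj j : (0 < j <= m)%N -> G j t0 = 0.
  move=> /andP[j0 jm]; rewrite /G pj//; case: eqVneq => [->|jm']; first by ring.
  by rewrite Fj ?j0 ?ltn_neqAle ?jm'//; ring.
have [D D0 HD] := taylor_bound _ _ _ _ dG (lip_on_lin T _ _ _ _ (-1) lC lC') It0 Gj.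
have [L L0 lL] := derivs_lip T T0 _ _ _ dF lF 0%N isT.
pose s := F 0%N t0.
have ss : s * s = 1 by rewrite -expr2 -real_normK ?num_real// /s Ft0 expr1n.
have A0 : 0 < `|a| by rewrite normr_gt0.
have D1 : 0 < D + 1 by rewrite ltr_wpDl.
have L1 : 0 < L + 1 by rewrite ltr_wpDl.
exists (`|a| / 2); first by rewrite divr_gt0.
(* the first bound makes the rest at most half of the leading term, the second
   one keeps the sign of [F 0] the same as at [t0] *)
exists (Num.min (`|a| / 2 / (D + 1)) (L + 1)^-1).
  by rewrite lt_min !divr_gt0// invr_gt0.
move=> t It; rewrite lt_min => /andP[td tL].
set h := `|t - t0| in td tL *.
have h0 : 0 <= h by rewrite normr_ge0.
pose r := G 0%N t - G 0%N t0.
have Dh : D * h <= `|a| / 2.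
  move: td; rewrite ltr_pdivlMr// => /ltW; apply: le_trans.
  by rewrite mulrC ler_wpM2l// lerDl.
have Hr : `|r| <= `|a| / 2 * h ^+ m.
  apply: le_trans (HD t It) _; rewrite -/h exprS mulrA ler_wpM2r//.
  by rewrite exprn_ge0.
have E : F 0%N t = s + a * (t - t0) ^+ m + r.
  have pt : (p^`(0)).[t] = a * (t - t0) ^+ m.
    by rewrite derivn0 hornerZ horner_exp hornerXsubC.
  by rewrite /r /G pj// (ltn_eqF m0) pt /s; ring.
have sF : 0 <= s * F 0%N t.
  have := lL t t0 It It0; rewrite -/s -/h => Hl.
  have : `|F 0%N t - s| <= 1.
    apply: le_trans Hl _; move: tL; rewrite -[X in _ < X]div1r ltr_pdivlMr// => /ltW.
    by apply: le_trans; rewrite mulrC ler_wpM2l// lerDl.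
  have s1 : `|s| = 1 by [].
  rewrite -[ `|F 0%N t - s|]mul1r -s1 -normrM mulrBr ss ler_distl; lra.
have nF : `|F 0%N t| = s * F 0%N t.
  by rewrite -[LHS]mul1r -Ft0 -normrM ger0_norm.
set X := s * (a * (t - t0) ^+ m).
have nX : `|X| = `|a| * h ^+ m by rewrite !normrM Ft0 mul1r normrX.
have Hsr : `|s * r| <= `|a| / 2 * h ^+ m by rewrite normrM Ft0 mul1r.
have sE : s * F 0%N t = 1 + X + s * r by rewrite E !mulrDr ss.
have le1 : s * F 0%N t <= 1 by rewrite -nF F1.
rewrite nF sE; rewrite sE in le1.
move: Hsr; rewrite ler_norml => /andP[r1 r2].
have [X0|X0] := leP X 0.
  by move: nX; rewrite ler0_norm//; lra.
move: nX; rewrite gtr0_norm//; lra.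
Qed.

Lemma poly_eq0_on p : (forall t, I t -> p.[t] = 0) -> p = 0.
Proof.
move=> p0; pose rs := [seq T / (i.+1)%:R | i <- iota 0 (size p)].
apply: (@roots_geq_poly_eq0 _ _ rs).
- apply/allP => _ /mapP[i _ ->]; apply/rootP/p0.
  rewrite /= in_itv/=; apply/andP; split; first by rewrite divr_ge0// ltW.
  by rewrite ler_pdivrMr ?ltr0n// ler_peMr ?(ltW T0)// ler1n.
- rewrite map_inj_uniq ?iota_uniq// => i j /(mulfI (lt0r_neq0 T0)) /invr_inj.
  by move=> /eqP; rewrite eqr_nat eqSS => /eqP.
- by rewrite size_map size_iota.
Qed.

End Taylor.

(** * Multiplicities of contacts and zeros of polynomials *)

Section NatEsum.
Context {R : realType} {X : choiceType}.
Variables (S : set X) (m : X -> nat).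

Lemma fsum_nat (A : set X) : finite_set A ->
  (\sum_(x \in A) ((m x)%:R : R)%:E = ((\sum_(x <- fset_set A) m x)%N%:R : R)%:E)%E.
Proof. by move=> fA; rewrite fsumEFin// fsbig_finite// natr_sum. Qed.

(** The partial sums are integers, so a supremum at least [n] is already
    reached by a finite sum. *)
Lemma esum_nat_ge n : ((n%:R : R)%:E <= \esum_(x in S) ((m x)%:R)%:E)%E <->
  exists s : seq X, [/\ uniq s, forall x, x \in s -> S x & (n <= \sum_(x <- s) m x)%N].
Proof.
split=> [H|[s [us sS ns]]]; last first.
  apply: esum_ge; exists [set` s].
    by split; [exact: finite_seq|move=> x /sS].
  rewrite -fsbig_seq// sumEFin lee_fin -natr_sum ler_nat//.
apply: contrapT => nex; case: n => [|n] in H nex.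
  by apply: nex; exists [::].
move: H; rewrite leNgt => /negP; apply.
apply: (@le_lt_trans _ _ (n%:R : R)%:E); last by rewrite lte_fin ltr_nat.
apply: ge_ereal_sup => _ /= [A [fA AS] <-]; rewrite fsum_nat// lee_fin ler_nat.
rewrite leqNgt; apply/negP => nA; apply: nex; exists (fset_set A); split => //.
by move=> x; rewrite in_fset_set// => /set_mem/AS.
Qed.

(** Every element of [S] contributes at least [1], so a sum below [n] makes [S]
    finite. *)
Lemma esum_nat_lt n : (forall x, S x -> (0 < m x)%N) ->
  ~ ((n%:R : R)%:E <= \esum_(x in S) ((m x)%:R)%:E)%E ->
  exists s : seq X, [/\ uniq s, forall x, S x <-> x \in s & (\sum_(x <- s) m x < n)%N].
Proof.
move=> m0 /esum_nat_ge nex; case: (pselect (finite_set S)) => [fS|/infinite_set_fset iS].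
  exists (fset_set S); split => // [x|].
    by rewrite in_fset_set//; split=> [/mem_set|/set_mem].
  rewrite ltnNge; apply/negP => nS; apply: nex; exists (fset_set S); split => // x.
  by rewrite in_fset_set// => /set_mem.
have [B BS nB] := iS n; exfalso; apply: nex; exists B; split; [exact: fset_uniq|by move=> x /BS|].
apply: (leq_trans nB); rewrite -sum1_size big_seq [leqRHS]big_seq.
by apply: leq_sum => x /BS/m0.
Qed.

End NatEsum.

Section ContactPolynomial.
Context {R : realType}.
Implicit Types (p : {poly R}) (s : seq R) (m : R -> nat).

Definition node_poly s m : {poly R} := \prod_(x <- s) ('X - x%:P) ^+ m x.

Lemma node_poly_neq0 s m : node_poly s m != 0.
Proof.
by apply/monic_neq0/rpred_prod => x _; rewrite monic_exp// monicXsubC.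
Qed.

Lemma size_node_poly s m : size (node_poly s m) = (\sum_(x <- s) m x).+1.
Proof.
rewrite /node_poly; elim: s => [|x s IH]; first by rewrite !big_nil size_poly1.
rewrite !big_cons size_monicM ?monic_exp ?monicXsubC//; last exact: node_poly_neq0.
by rewrite IH size_exp_XsubC addSn addnS.
Qed.

Lemma node_poly_dvd s m p : uniq s ->
  (forall x, x \in s -> ('X - x%:P) ^+ m x %| p) -> node_poly s m %| p.
Proof.
rewrite /node_poly; elim: s => [|x s IH]; first by rewrite big_nil dvd1p.
rewrite cons_uniq big_cons => /andP[xs us] H; rewrite Gauss_dvdp.
  by rewrite H ?mem_head//= IH// => y ys; rewrite H// in_cons ys orbT.
apply: coprimep_expl; rewrite coprimep_sym coprimep_XsubC.
elim: s xs {IH us H} => [|y s IH]; first by rewrite big_nil root1.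
rewrite in_cons negb_or => /andP[xy /IH xs]; rewrite big_cons rootM negb_or xs andbT.
by rewrite /root horner_exp hornerXsubC expf_neq0// subr_eq0.
Qed.

Variable T : R.
Hypothesis T0 : 0 < T.
Local Notation I := (`[0, T]%classic : set R).

Lemma itv_dist_le t t0 : I t -> I t0 -> `|t - t0| <= T.
Proof. by rewrite /= !in_itv/= ler_norml; lra. Qed.

Lemma node_poly_le s m x : x \in s ->
  exists2 C, 0 <= C & forall t, I t -> `|(node_poly s m).[t]| <= C * `|t - x| ^+ m x.
Proof.
move=> xs; pose q := \prod_(y <- rem x s) ('X - y%:P) ^+ m y.
have E : node_poly s m = ('X - x%:P) ^+ m x * q.
  by rewrite /node_poly (perm_big _ (perm_to_rem xs)) big_cons.
have [L _ lq] := lip_horner T T0 q; have [C C0 HC] := lip_bounded T T0 _ _ lq.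
exists C => // t It; rewrite E hornerM horner_exp hornerXsubC normrM normrX mulrC.
by rewrite ler_wpM2r ?exprn_ge0// HC.
Qed.

(** Writing [p = q (X - t0)^j] with [q] nonzero at [t0], an order of vanishing
    [m > j] would force [q] to tend to [0] at [t0]. *)
Lemma vanish_dvd p C t0 (m : nat) : I t0 -> 0 <= C ->
  (forall t, I t -> `|p.[t]| <= C * `|t - t0| ^+ m) -> ('X - t0%:P) ^+ m %| p.
Proof.
move=> It0 C0 Hp; have [->|p0] := eqVneq p 0; first exact: dvdp0.
have [j [q]] := multiplicity_XsubC p t0; rewrite p0 /= => rq pE.
have [mj|jm] := leqP m j; first by rewrite pE dvdp_mull// dvdp_exp2l.
exfalso; move/negP: rq; apply; apply/rootP/eqP.
have [L L0 lL] := lip_horner T T0 q.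
rewrite -normr_le0; apply/ler_addgt0Pl => e e0; rewrite addr0.
pose D := C * T ^+ (m - j).-1 + L.
have D0 : 0 <= D by rewrite addr_ge0// mulr_ge0// exprn_ge0// ltW.
have D1 : 0 < D + 1 by rewrite ltr_wpDl.
have [t It [tt0 te]] := itv_accumulation T T0 t0 _ It0 (divr_gt0 e0 D1).
have h0 : 0 < `|t - t0| by rewrite normr_gt0 subr_eq0.
have qt : `|q.[t]| <= C * T ^+ (m - j).-1 * `|t - t0|.
  have := Hp t It; rewrite pE hornerM horner_exp hornerXsubC normrM normrX.
  rewrite -{1}(subnK (ltnW jm)) exprD mulrA ler_pM2r ?exprn_gt0// => /le_trans; apply.
  rewrite -(prednK (n := m - j)) ?subn_gt0// exprSr mulrA ler_wpM2r//.
  by rewrite ler_wpM2l// lerXn2r ?nnegrE ?(ltW T0)//= itv_dist_le.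
move: te; rewrite ltr_pdivlMr// => /ltW; apply: le_trans.
apply: (@le_trans _ _ (D * `|t - t0|)); last first.
  by rewrite mulrC ler_wpM2l// lerDl.
rewrite -[q.[t0]](subrK q.[t]) addrC (le_trans (ler_normD _ _))// mulrDl lerD//.
by rewrite distrC lL.
Qed.

End ContactPolynomial.

(** * Extreme functions have contacts of total multiplicity at least n *)

Section ExtremeContacts.
Context {R : realType}.
Variables (T : R) (n : nat) (f : R -> R).
Hypotheses (T0 : 0 < T) (n0 : (0 < n)%N) (Lf : L_class n T f).
Local Notation I := (`[0, T]%classic : set R).
Local Notation mult := (multiplicity n T f).

Lemma L_class_le1 t : I t -> `|f t| <= 1.
Proof. by move=> It; have [_ f1 _] := Lf; exact: f1. Qed.

Lemma L_class_lip_derivn : forall j, (j <= n.-1)%N ->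
  exists2 C, 0 <= C & lip_on T C (derivn_in I j f).
Proof.
exact: (derivs_lip T T0 _ _ _ (L_class_derivs _ _ _ Lf) (L_class_lip _ _ n0 _ Lf)).
Qed.

(** At a contact of multiplicity [m] the derivatives of order [1] to [m - 1]
    vanish, so the gap [1 - |f|] is at most of order [m]. This is what makes the
    multiplicity of a contact a lower bound on the multiplicity of the zeros of
    admissible perturbations. *)
Lemma contact_upper_bound t0 : contact_set T f t0 ->
  exists2 C, 0 <= C & forall t, I t -> 1 - `|f t| <= C * `|t - t0| ^+ mult t0.
Proof.
move=> [It0 ft0]; have [/andP[m0 mn] mj _] := multiplicityP T f t0 n0.
have mn' : ((mult t0).-1 <= n.-1)%N by rewrite -!subn1 leq_sub2r.
have [K K0 lK] := L_class_lip_derivn _ mn'.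
have [|C C0 HC] := taylor_bound T _ (derivn_in I ^~ f) K t0 _ lK It0 mj.
  by move=> j t jm; apply: (L_class_derivs _ _ _ Lf); exact: leq_trans mn'.
exists C => // t It; have := HC t It; rewrite prednK// distrC; apply: le_trans.
by rewrite -ft0 lerBlDr (le_trans _ (ler_normD _ _))// subrK.
Qed.

(** A function vanishing to the order of the contact can be scaled to fit into
    the gap [1 - |f|] near that contact. The multiplicity has to be less than
    [n]: a contact of multiplicity [n] may have no gap at all around it. *)
Lemma contact_local (p : R -> R) C t0 : contact_set T f t0 -> (mult t0 < n)%N -> 0 <= C ->
  (forall t, I t -> `|p t| <= C * `|t - t0| ^+ mult t0) ->
  exists2 e, 0 < e & exists2 d, 0 < d &
    forall t, I t -> `|t - t0| < d -> e * `|p t| <= 1 - `|f t|.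
Proof.
move=> [It0 ft0] mn C0 Hp; have [/andP[m0 _] mj mP] := multiplicityP T f t0 n0.
have nz : derivn_in I (mult t0) f t0 != 0.
  by case: mP => [mn'|[]//]; rewrite mn' ltnn in mn.
have mn' : (0 < mult t0 <= n.-1)%N by rewrite m0 -ltnS prednK.
have [|c c0 [d d0 H]] := contact_lower_bound T T0 n.-1 (derivn_in I ^~ f) 1 (mult t0) t0
  (L_class_derivs _ _ _ Lf) (L_class_lip _ _ n0 _ Lf) mn' It0 L_class_le1 ft0 _ nz.
  by move=> j; rewrite -{1}(prednK m0) ltnS; exact: mj.
have C1 : 0 < C + 1 by rewrite ltr_wpDl.
exists (c / (C + 1)); first by rewrite divr_gt0.
exists d => // t It td; apply: le_trans (H t It td).
apply: (@le_trans _ _ (c / (C + 1) * ((C + 1) * `|t - t0| ^+ mult t0))).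
  rewrite ler_wpM2l ?divr_ge0 ?(ltW c0) ?(ltW C1)// (le_trans (Hp t It))//.
  by rewrite ler_wpM2r ?exprn_ge0// lerDl.
by rewrite mulrA divfK// gt_eqF.
Qed.

Lemma noncontact_local (p : R -> R) C t0 : I t0 -> `|f t0| != 1 -> 0 <= C ->
  (forall t, I t -> `|p t| <= C) ->
  exists2 e, 0 < e & exists2 d, 0 < d &
    forall t, I t -> `|t - t0| < d -> e * `|p t| <= 1 - `|f t|.
Proof.
move=> It0 ft0 C0 Hp.
have f1 : 0 < 1 - `|f t0| by rewrite subr_gt0 lt_neqAle ft0 L_class_le1.
have [L L0 lL] := L_class_lip_derivn 0%N isT.
have C1 : 0 < C + 1 by rewrite ltr_wpDl.
have L1 : 0 < L + 1 by rewrite ltr_wpDl.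
exists ((1 - `|f t0|) / 2 / (C + 1)); first by rewrite !divr_gt0.
exists ((1 - `|f t0|) / 2 / (L + 1)); first by rewrite !divr_gt0.
move=> t It td; apply: (@le_trans _ _ ((1 - `|f t0|) / 2)).
  rewrite mulrAC ler_pdivrMr// ler_wpM2l//; first by rewrite divr_ge0// ltW.
  by rewrite (le_trans (Hp t It))// lerDl.
have : `|f t - f t0| <= (1 - `|f t0|) / 2.
  apply: le_trans (lL t t0 It It0) _.
  move: td; rewrite ltr_pdivlMr// => /ltW; apply: le_trans.
  by rewrite mulrC ler_wpM2l// lerDl.
have := ler_normD (f t - f t0) (f t0); rewrite subrK; lra.
Qed.

(** If the multiplicities add up to less than [n], the polynomial with exactly
    these zeros has degree less than [n], hence a vanishing [n]-th derivative,
    and a small multiple of it fits below [1 - |f|], so [f] is a midpoint. *)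
Lemma extreme_sum_multiplicities : extreme_point (L_class n T) f ->
  (n%:R%:E <= sum_multiplicities n T f)%E.
Proof.
move=> ext; apply: contrapT => /esum_nat_lt[|s [us sP sn]].
  by move=> t _; have [/andP[]] := multiplicityP T f t n0.
set p := node_poly s mult.
(* compactness: the admissible local scales are glued by taking minima *)
have [e e0 He] : exists2 e, 0 < e &
    forall t, 0 <= t -> t <= T -> e * `|p.[t]| <= 1 - `|f t|.
  apply: (cousin_additive (fun x y => exists2 e, 0 < e &
    forall t, x <= t -> t <= y -> e * `|p.[t]| <= 1 - `|f t|)); first exact: ltW.
    move=> x y z xy yz [e e0 He] [e' e'0 He'].
    exists (Num.min e e'); first by rewrite lt_min e0.
    move=> t xt tz; have [ty|/ltW yt] := leP t y.
      apply: le_trans (He t xt ty); rewrite ler_wpM2r//.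
      by rewrite ge_min lexx.
    apply: le_trans (He' t yt tz); rewrite ler_wpM2r//.
    by rewrite ge_min lexx orbT.
  move=> t tT; have It : I t by rewrite /= in_itv.
  suff [e e0 [d d0 H]] : exists2 e, 0 < e & exists2 d, 0 < d &
      forall u, I u -> `|u - t| < d -> e * `|p.[u]| <= 1 - `|f u|.
    exists d => // x y x0 xt ty yT dx dy; exists e => // u xu uy; apply: H.
      by rewrite /= in_itv/= (le_trans x0 xu) (le_trans uy).
    by rewrite ltr_distl; apply/andP; split; lra.
  case: (pselect (contact_set T f t)) => [ct|nct].
    have ts : t \in s by apply/sP.
    have [C C0 HC] := node_poly_le T T0 s mult t ts.
    apply: (contact_local (horner p) C) => //.
    by apply: leq_ltn_trans sn; rewrite (big_rem t)//= leq_addr.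
  have [L _ lp] := lip_horner T T0 p; have [C C0 HC] := lip_bounded T T0 _ _ lp.
  apply: (noncontact_local _ C) => //.
  by apply/eqP => ft; apply: nct; split.
have p0 : e *: p != 0.
  by rewrite scaler_eq0 negb_or gt_eqF//= node_poly_neq0.
have sz : (size (e *: p) <= n)%N.
  by rewrite size_scale ?gt_eqF// size_node_poly.
move/eqP: p0; apply; apply: (poly_eq0_on T T0).
have [L L0 lL] := lip_horner T T0 ((e *: p)^`(n.-1)).
apply: (extreme_no_perturbation T n T0 n0 f (fun j t => ((e *: p)^`(j)).[t]) L ext) => //.
- exact: derivs_horner.
- move=> t It; rewrite /= hornerZ normrM (gtr0_norm e0).
  by move: It; rewrite /= in_itv/= => /andP[t0 tT]; have := He t t0 tT; lra.
- apply: ae_imply (L_class_ae T n n0 f Lf) => t H It; have [_ ft] := H It.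
  split; last by rewrite derivn_poly0// horner0 normr0 addr0.
  by have := derivs_horner T (e *: p) n n.-1 t; rewrite !prednK// leqnn => /(_ isT It).
Qed.

End ExtremeContacts.

(** * Sufficiency of the two conditions *)

Section NullSets.
Context {R : realType}.
Local Notation mu := (@lebesgue_measure R).

Lemma ae_forall_countable (X : countType) (P : X -> R -> Prop) :
  (forall x, {ae mu, forall t, P x t}) -> {ae mu, forall t, forall x, P x t}.
Proof.
move=> aeP; pose Q k t := if @choice.unpickle X k is Some x then P x t else True.
have : {ae mu, forall t, forall k, Q k t}.
  apply: ae_foralln => k; rewrite /Q; case: (choice.unpickle k) => [x|]; first exact: aeP.
  exact: aeW.
by apply: ae_imply => t Qt x; have := Qt (choice.pickle x); rewrite /Q choice.pickleK.
Qed.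

Lemma ae_subsingleton (N : set R) : (forall s t, N s -> N t -> s = t) ->
  {ae mu, forall t, ~ N t}.
Proof.
move=> N1; case: (pselect (exists a, N a)) => [[a Na]|nN]; last first.
  by apply: aeW => t Nt; apply: nN; exists t.
exists [set a]; split => //; first exact: lebesgue_measure_set1.
by move=> t /= /contrapT Nt; exact: N1.
Qed.

(** A zero at which the derivative does not vanish is an isolated zero, and a
    set of reals has countably many isolated points, each being singled out by
    an interval with rational endpoints. *)
Lemma ae_deriv_zero (I : set R) (H : R -> R) :
  {ae mu, forall t, I t -> H t = 0 -> forall l, has_der I H t l -> l = 0}.
Proof.
(* [N pq]: the zeros which are alone in the rational interval [pq] *)
pose N (pq : rat * rat) : set R := [set t | ratr pq.1 < t < ratr pq.2 /\
  (I t /\ H t = 0 /\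
  (forall s, ratr pq.1 < s < ratr pq.2 -> I s -> H s = 0 -> s = t))].
have : {ae mu, forall t, forall pq, ~ N pq t}.
  apply: ae_forall_countable => pq; apply: ae_subsingleton => s t.
  by move=> [spq [Is [Hs _]]] [_ [_ [_ tu]]]; exact: tu.
apply: ae_imply => t Nt It Ht l dl; apply/eqP/negPn/negP => l0.
have l0' : 0 < `|l| by rewrite normr_gt0.
have [d d0 Hd] := dl _ (divr_gt0 l0' (ltr0n R 2)).
have [p] : exists q, ratr q \in `]t - d, t[ by apply: rat_in_itvoo; rewrite ltrBlDr ltrDl.
rewrite in_itv/= => /andP[p1 p2].
have [q] : exists q, ratr q \in `]t, t + d[ by apply: rat_in_itvoo; rewrite ltrDl.
rewrite in_itv/= => /andP[q1 q2].
apply: (Nt (p, q)); split => /=; first by rewrite p2.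
split => //; split => // s /andP[ps sq] Is Hs.
apply/eqP; rewrite -subr_eq0 -normr_eq0.
have := Hd s Is; rewrite Ht Hs subrr sub0r normrN normrM.
rewrite ltr_distl => /(_ ltac:(by apply/andP; split; lra)).
have := normr_ge0 (s - t); nra.
Qed.

End NullSets.

Section PolynomialTower.
Context {R : realType}.
Variable T : R.
Hypothesis T0 : 0 < T.
Local Notation I := (`[0, T]%classic : set R).

Lemma poly_antiderivative (p : {poly R}) :
  exists2 q : {poly R}, q^`() = p & (size q <= (size p).+1)%N.
Proof.
exists (\poly_(i < (size p).+1) (p`_i.-1 / i%:R)); last exact: size_poly.
apply/polyP => i; rewrite coef_deriv coef_poly ltnS.
case: ltnP => ip; last by rewrite mul0rn nth_default.
by rewrite -[LHS]mulr_natr divfK// pnatr_eq0.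
Qed.

Lemma derivs_const_poly k (F : nat -> R -> R) : derivs T k F -> lip_on T 0 (F k) ->
  exists2 p : {poly R}, (size p <= k.+1)%N & forall t, I t -> F 0%N t = p.[t].
Proof.
have I0 : I 0 by rewrite /= in_itv/= lexx ltW.
have const G : lip_on T 0 G -> forall t, I t -> G t = G 0.
  move=> lG t It; apply/eqP; rewrite -subr_eq0 -normr_le0.
  by have := lG t 0 It I0; rewrite mul0r.
elim: k F => [|k IH] F dF lF.
  exists (F 0%N 0)%:P; first exact: size_polyC_leq1.
  by move=> t It; rewrite hornerC const.
have [|p sp pE] := IH (fun j => F j.+1) _ lF.
  by move=> j t jk It; exact: (dF j.+1).
have [q qp sq] := poly_antiderivative p.
have lq : lip_on T 0 (fun t => F 0%N t + (-1) * q.[t]).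
  apply: has_der_lip => t It; exists 0; last by rewrite normr0.
  have e : F 1%N t + (-1) * (q^`()).[t] = 0 by rewrite qp -pE//; ring.
  rewrite -[X in has_der _ _ _ X]e.
  by apply: has_der_lin; [exact: dF|exact: has_der_horner].
exists (q + (F 0%N 0 + (-1) * q.[0])%:P).
  rewrite (leq_trans (size_polyD _ _))// geq_max (leq_trans sq) ?ltnS//=.
  by rewrite (leq_trans (size_polyC_leq1 _)).
by move=> t It; rewrite hornerD hornerC -(const _ lq t It); ring.
Qed.

End PolynomialTower.

Section Sufficiency.
Context {R : realType}.
Variables (T : R) (n : nat) (f : R -> R).
Hypotheses (T0 : 0 < T) (n0 : (0 < n)%N) (Lf : L_class n T f).
Local Notation I := (`[0, T]%classic : set R).
Local Notation mu := (@lebesgue_measure R).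
Local Notation mult := (multiplicity n T f).

(** On [Z] the argument climbs the tower: [F 0] vanishes on [Z], hence almost
    everywhere on [Z] so does its derivative [F 1], and so on up to [F n]. *)
Lemma derivs_ae_zero (F : nat -> R -> R) (Z : set R) : derivs T n.-1 F ->
  {ae mu, forall t, I t -> has_der I (F n.-1) t (F n t)} ->
  (forall t, Z t -> F 0%N t = 0) ->
  {ae mu, forall t, (I `\` Z) t -> F n t = 0} ->
  {ae mu, forall t, I t -> F n t = 0}.
Proof.
move=> dF aeF FZ FnZ.
have := ae_foralln (fun j => ae_deriv_zero I (F j)).
have {FnZ} := ae_imply2 _ _ _ (fun t P Q => conj P Q) aeF FnZ.
apply: ae_imply2 => t [dn FnZ] dz It.
case: (pselect (Z t)) => [Zt|nZt]; last exact: FnZ.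
have F0 j : (j <= n.-1)%N -> F j t = 0.
  elim: j => [|j IH] jn; first exact: FZ.
  by apply: (dz j) => //; [apply: IH; exact: ltnW|exact: dF].
by apply: (dz n.-1) => //; [exact: F0|exact: dn].
Qed.

(** The [n]-th derivative vanishes almost everywhere, so [F 0] is a polynomial
    of degree less than [n]; the gap bound makes it vanish at each contact to
    the order of its multiplicity, which is at least [n] zeros in total. *)
Lemma vanish_from_contacts (F : nat -> R -> R) K : derivs T n.-1 F ->
  lip_on T K (F n.-1) ->
  {ae mu, forall t, I t -> has_der I (F n.-1) t (F n t)} ->
  {ae mu, forall t, (I `\` contact_set T f) t -> F n t = 0} ->
  (forall t, I t -> `|F 0%N t| <= 2 * (1 - `|f t|)) ->
  (n%:R%:E <= sum_multiplicities n T f)%E ->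
  forall t, I t -> F 0%N t = 0.
Proof.
move=> dF lF aeF FnZ F1 /esum_nat_ge[s [us sP ns]].
have Fc t : contact_set T f t -> F 0%N t = 0.
  move=> [It ft]; apply/eqP; rewrite -normr_le0.
  by have := F1 t It; rewrite ft subrr mulr0.
have Fn0 := derivs_ae_zero F _ dF aeF Fc FnZ.
have lF0 : lip_on T 0 (F n.-1).
  apply: ac_has_der_lip => //; first exact: lip_ac lF.
  apply: ae_imply2 aeF Fn0 => t dt zt It; exists 0; last by rewrite normr0.
  by rewrite -[X in has_der _ _ _ X](zt It); exact: dt.
have [p sp pE] := derivs_const_poly T T0 _ _ dF lF0.
rewrite prednK// in sp.
have dp : node_poly s mult %| p.
  apply: node_poly_dvd => // x xs; have cx := sP x xs.
  have [C C0 HC] := contact_upper_bound T n f T0 n0 Lf x cx.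
  apply: (vanish_dvd T T0 _ (2 * C)); [by case: cx|exact: mulr_ge0|].
  move=> t It; rewrite -pE// (le_trans (F1 t It))// -mulrA ler_pM2l//.
  exact: HC.
have p0 : p = 0.
  apply/eqP/negPn/negP => p0; have := dvdp_leq p0 dp.
  by rewrite size_node_poly => /(leq_trans (leq_ltn_trans ns (ltnSn _)))/leq_trans/(_ sp); rewrite ltnn.
by move=> t It; rewrite pE// p0 horner0.
Qed.

(** If [f] is the midpoint of [g] and [h], then [F 0 = g - h] satisfies
    [|f| + |F 0| / 2 <= 1], because [f + F 0 / 2] and [f - F 0 / 2] are [g] and
    [h]; the same inequality between [n]-th derivatives annihilates [F n]
    wherever [|f^(n)| = 1]. *)
Lemma extreme_of_contacts : (n%:R%:E <= sum_multiplicities n T f)%E ->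
  {ae mu, forall t, (I `\` contact_set T f) t -> `|derivn_in I n f t| = 1} ->
  extreme_point (L_class n T) f.
Proof.
move=> fsum fae; split => // g h Lg Lh E.
have {}E t : f t + f t = g t + h t.
  by have := congr1 (fun u => u t) E; rewrite mulr2n.
pose F j t := derivn_in I j g t + (-1) * derivn_in I j h t.
pose G j t := derivn_in I j g t + (- 2^-1) * F j t.
have dF : derivs T n.-1 F by apply: derivs_lin; exact: L_class_derivs.
have dG : derivs T n.-1 G by apply: derivs_lin => //; exact: L_class_derivs.
have GE j t : (j <= n.-1)%N -> I t -> derivn_in I j f t = G j t.
  apply: derivs_derivn_in => // u Iu; rewrite /G /F /=.
  by have := E u; lra.
have lF : lip_on T (1 + `|-1| * 1) (F n.-1) by apply: lip_on_lin; exact: L_class_lip.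
have aeF : {ae mu, forall t, I t -> has_der I (F n.-1) t (F n t)}.
  apply: ae_imply2 (L_class_ae T n n0 g Lg) (L_class_ae T n n0 h Lh) => t dg dh It.
  by have [dg1 _] := dg It; have [dh1 _] := dh It; exact: has_der_lin.
have FnZ : {ae mu, forall t, (I `\` contact_set T f) t -> F n t = 0}.
  have := ae_imply2 _ _ _ (fun t P Q => conj P Q)
    (L_class_ae T n n0 g Lg) (L_class_ae T n n0 h Lh).
  move=> /(ae_imply2 _ _ _ (fun t P Q => conj P Q) fae).
  apply: ae_imply2 aeF => t dFt [ft [dg dh]] It; have {}ft := ft It; case: It => It _.
  have [dg1 g1] := dg It; have [dh1 h1] := dh It.
  have fn : derivn_in I n f t = G n t.
    rewrite derivn_in_pred//; apply: has_der_deriv_in => //.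
    apply: (has_der_ext I (G n.-1)) => //; first by move=> u Iu; rewrite GE.
    by apply: has_der_lin => //; exact: dFt.
  move: ft g1 h1; rewrite fn /G /F => ft.
  rewrite !ler_norml; move: ft.
  have [w|w] := leP 0 (derivn_in I n g t + - 2^-1 * (derivn_in I n g t + -1 * derivn_in I n h t)).
    by rewrite ger0_norm//; lra.
  by rewrite ltr0_norm//; lra.
have F1 t : I t -> `|F 0%N t| <= 2 * (1 - `|f t|).
  move=> It; have := L_class_le1 T n g Lg t It; have := L_class_le1 T n h Lh t It.
  have := E t; rewrite /F /= !ler_norml.
  by have [w|w] := leP 0 (f t); [rewrite ger0_norm|rewrite ltr0_norm]; lra.
apply/funext => t; case: (pselect (I t)) => It.
  have := vanish_from_contacts F _ dF lF aeF FnZ F1 fsum t It; rewrite /F /=; lra.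
by have [[-> // _ _] _ _] := Lg; have [[-> // _ _] _ _] := Lh.
Qed.

End Sufficiency.

(** * Primitives and measurable derivatives *)

Section Antiderivatives.
Context {R : realType}.
Variable T : R.
Hypothesis T0 : 0 < T.
Local Notation I := (`[0, T]%classic : set R).
Local Notation mu := (@lebesgue_measure R).
Implicit Types (h H u G : R -> R).

Definition clamp (t : R) : R := Num.max 0 (Num.min T t).

Lemma clamp_id t : I t -> clamp t = t.
Proof. by rewrite /clamp /= in_itv/= => /andP[t0 tT]; rewrite min_r// max_r. Qed.

Lemma clamp_in t : I (clamp t).
Proof.
rewrite /clamp /= in_itv/= le_max lexx /= ge_max ltW//=.
by rewrite ge_min lexx.
Qed.

Lemma clamp_dist s t : `|clamp s - clamp t| <= `|s - t|.
Proof.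
wlog st : s t / s <= t.
  by move=> W; have [/W//|/ltW/W] := leP s t; rewrite distrC (distrC t).
rewrite distrC (distrC s) !ger0_norm ?subr_ge0//; rewrite /clamp !maxEle !minEle;
  case: (leP T s) => ? /=; case: (leP T t) => ? /=; rewrite ?(ltW T0) ?lexx;
  case: (leP 0 s) => ? /=; case: (leP 0 t) => ? /=; first [lra|exact: ltW].
Qed.

Lemma lip_clamp K h s t : lip_on T K h ->
  `|h (clamp s) - h (clamp t)| <= `|K| * `|s - t|.
Proof.
move=> lh; apply: (le_trans (lh _ _ (clamp_in s) (clamp_in t))).
rewrite (le_trans (ler_wpM2r _ (ler_norm K)))// ler_wpM2l//.
exact: clamp_dist.
Qed.

Lemma lip_continuous K h : (forall s t, `|h s - h t| <= K * `|s - t|) ->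
  continuous h.
Proof.
move=> lh t; apply/cvgrPdist_le => e e0.
have K0 : 0 < `|K| + 1 by rewrite ltr_wpDl.
apply/nbhs_ballP; exists (e / (`|K| + 1)); first by rewrite /= divr_gt0.
move=> s; rewrite /ball/= ltr_pdivlMr// => /ltW; apply: le_trans.
apply: le_trans (lh t s) _; rewrite mulrC ler_wpM2l//.
by rewrite (le_trans (ler_norm K))// lerDl.
Qed.

(** Composing with [clamp] extends [h] continuously to the real line, so the
    derivative of its integral is two-sided even at [0] and [T]. *)
Lemma lip_antiderivative K h : lip_on T K h ->
  exists2 H, H 0 = 0 & forall t, I t -> has_der I H t (h t).
Proof.
move=> lh; pose g := h \o clamp.
have cg : continuous g.
  by apply: (lip_continuous `|K|) => s t; exact: lip_clamp.
pose H0 y := (\int[mu]_(x in [set` Interval (BLeft (-1)) (BRight y)]) g x)%R.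
have ig : mu.-integrable [set` Interval (BLeft (-1)) (BRight (T + 1))] (EFin \o g).
  apply: continuous_compact_integrable; first exact: segment_compact.
  exact: continuous_subspaceT.
exists (fun t => H0 t + (-1) * H0 0); first by ring.
move=> t It; have [t0 tT] : 0 <= t /\ t <= T.
  by move: It; rewrite /= in_itv/= => /andP[].
have tu : t < T + 1 by lra.
have [|dH Ht] := continuous_FTC1 tu ig _ (cg t); first by rewrite (@lte_fin R); lra.
have := has_der_lin I _ _ t _ (-1) _
  (has_derS _ _ _ _ _ (@subsetT _ I) (has_der_derivable _ _ dH)) (has_der_cst I (H0 0) t).
by rewrite mulr0 addr0 Ht /g /= clamp_id.
Qed.

(** The derivative, wherever it exists, is the limit of the continuous functions
    [k (G (t + 1/k) - G t)], hence agrees with their upper limit, a measurable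
    function. These increments point to the right, which excludes [T]. *)
Lemma lip_deriv_measurable K G : lip_on T K G -> exists2 D : R -> R,
  measurable_fun setT D &
  forall t l, I t -> t < T -> has_der I G t l -> D t = l.
Proof.
move=> lG; pose g := G \o clamp.
have lg s t : `|g s - g t| <= `|K| * `|s - t| by exact: lip_clamp.
pose q (k : nat) t := k.+1%:R * (g (t + k.+1%:R^-1) - g t).
have qK k t : `|q k t| <= `|K|.
  rewrite /q normrM ger0_norm// mulrC -ler_pdivlMr ?ltr0n//.
  apply: le_trans (lg _ _) _; rewrite addrAC subrr add0r.
  by rewrite (@ger0_norm _ k.+1%:R^-1) ?invr_ge0.
exists (fun t => limn_sup (q ^~ t)).
  apply: measurable_fun_limn_sup.
  - move=> t _; exists `|K| => _ [k _ <-]; exact: le_trans (ler_norm _) (qK k t).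
  - move=> t _; exists (- `|K|) => _ [k _ <-].
    by have := qK k t; rewrite ler_norml => /andP[].
  - move=> k; apply: continuous_measurable_fun.
    apply: (lip_continuous (k.+1%:R * (`|K| + `|K|))) => s t.
    rewrite /q -mulrBr normrM ger0_norm// -mulrA ler_wpM2l// mulrDl.
    set a := k.+1%:R^-1.
    have -> : g (s + a) - g s - (g (t + a) - g t) =
      (g (s + a) - g (t + a)) - (g s - g t) by ring.
    rewrite (le_trans (ler_normB _ _))// lerD// (le_trans (lg _ _))//.
    by have -> : s + a - (t + a) = s - t by ring.
move=> t l It tT dl; suff cq : q ^~ t @ \oo --> l.
  by have [_ ->] := cvg_limn_inf_sup cq.
apply/cvgrPdist_le => e e0; have [d d0 Hd] := dl e e0.
have m0 : 0 < Num.min d (T - t) by rewrite lt_min d0 subr_gt0.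
have [N _ HN] := near_infty_natSinv_lt (PosNum m0).
exists N => // k /= Nk; have := HN k Nk => /=; rewrite lt_min => /andP[kd kT].
have ik : 0 < k.+1%:R^-1 :> R by rewrite invr_gt0.
have Itk : I (t + k.+1%:R^-1).
  move: It; rewrite /= !in_itv/= => /andP[t0 _].
  by rewrite addr_ge0 ?(ltW ik)//= -lerBrDl ltW.
have dk : t + k.+1%:R^-1 - t = k.+1%:R^-1 by rewrite addrAC subrr add0r.
have := Hd _ Itk; rewrite dk (gtr0_norm ik) => /(_ kd).
rewrite /q /g /= !clamp_id// ler_pdivlMr ?ltr0n// => H.
have -> : l - k.+1%:R * (G (t + k.+1%:R^-1) - G t) =
   - ((G (t + k.+1%:R^-1) - G t - l * k.+1%:R^-1) * k.+1%:R).
  by field; rewrite lt0r_neq0.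
by rewrite normrN normrM (@ger0_norm _ k.+1%:R).
Qed.

Lemma itv_measure_lty b1 b2 (a b : R) :
  (mu [set` Interval (BSide b1 a) (BSide b2 b)] < +oo)%E.
Proof. by rewrite lebesgue_measure_itv/=; case: ifP => _; rewrite ?ltry. Qed.

(** This is Lebesgue's differentiation theorem for the integral of a bounded
    function. The indefinite integral starts at [-oo], which costs nothing as
    [u] is zero off [0, T], and is normalized at [0] afterwards. *)
Lemma bounded_primitive K u : measurable_fun setT u -> 0 <= K ->
  (forall t, `|u t| <= K) -> (forall t, ~ I t -> u t = 0) ->
  exists H, [/\ H 0 = 0, lip_on T K H &
    {ae mu, forall t, I t -> has_der I H t (u t)}].
Proof.
move=> mu_ K0 uK u0.
have iu : mu.-integrable setT (EFin \o u).
  have -> : EFin \o u = (EFin \o u) \_ I.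
    apply/funext => t; rewrite patchE; case: ifPn => //.
    by rewrite notin_setE => /u0 /= ->.
  apply: (@integrable_mkcond _ _ _ mu _ (EFin \o u) (measurable_itv `[0, T])).1.
  apply: measurable_bounded_integrable; first exact: measurable_itv.
  - exact: itv_measure_lty.
  - exact: measurable_funS mu_.
  - by exists K; split; [exact: num_real|move=> M KM t _; exact: le_trans (uK t) (ltW KM)].
have iA A : measurable A -> mu.-integrable A (EFin \o u) by move=> mA; exact: integrableS iu.
pose H0 y := (\int[mu]_(x in [set` `]-oo, y]]) u x)%R.
have dH0 : {ae mu, forall t, derivable H0 t 1 /\ derive1 H0 t = u t}.
  apply: FTC1Ny; first by move=> y; apply: iA.
  by apply: open_integrable_locally => //; exact: openT.
exists (fun t => H0 t + (-1) * H0 0); split; first by ring.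
- apply: lip_onW => s t _ _ st.
  have -> : H0 t + -1 * H0 0 - (H0 s + -1 * H0 0) = H0 t - H0 s by ring.
  rewrite /H0 (@Rintegral_itvB _ u -oo%O (BRight t) s)//; last by apply: iA; exact: measurable_itv.
  apply: le_trans (le_normr_Rintegral _ _) _; [by []|by apply: iA; exact: measurable_itv|].
  apply: (@le_trans _ _ (\int[mu]_(x in `]s, t]) K)%R).
    apply: le_Rintegral => //.
    + exact: (integrable_norm (iA _ (measurable_itv `]s, t]))).
    + apply: measurable_bounded_integrable => //.
        exact: itv_measure_lty.
      by exists K; split; [exact: num_real|move=> M KM x _ /=; rewrite ger0_norm// ltW].
  rewrite Rintegral_cst//= lebesgue_measure_itv/= lte_fin.
  by case: ltP => //= ts; rewrite mulr0 mulr_ge0// subr_ge0.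
- apply: ae_imply dH0 => t [dH Ht] It.
  have := has_der_lin I _ _ t _ (-1) _
    (has_derS _ _ _ _ _ (@subsetT _ I) (has_der_derivable _ _ dH)) (has_der_cst I (H0 0) t).
  by rewrite mulr0 addr0 Ht.
Qed.

(** The entry [k.+1] is set to [u] by hand: the intended [u] is a derivative of
    [psi] almost everywhere only, so it lies outside the reach of [derivs]. *)
Lemma antiderivative_tower k K psi u : lip_on T K psi -> psi 0 = 0 ->
  exists F, [/\ derivs T k F, F k = psi, F k.+1 = u &
    forall j, (j <= k)%N -> F j 0 = 0].
Proof.
move=> lpsi psi0; elim: k => [|k [F [dF Fk Fk1 F0]]].
  by exists (fun j => if j is 0 then psi else u); split => // -[].
have [|C _ lF] := derivs_lip T T0 k F K dF _ 0%N isT; first by rewrite Fk.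
have [H H0 dH] := lip_antiderivative C (F 0%N) lF.
exists (fun j => if j is i.+1 then F i else H); split => //.
- by case=> [|j] t jk It; [exact: dH|exact: dF].
- by case=> [|j] jk //; exact: F0.
Qed.

End Antiderivatives.

(** * The highest derivative of an extreme function off the contact set *)

Section Bump.
Context {R : realType}.
Variables (T : R) (n : nat).
Hypotheses (T0 : 0 < T) (n0 : (0 < n)%N).
Local Notation I := (`[0, T]%classic : set R).
Local Notation mu := (@lebesgue_measure R).

(** Almost every zero of [Q] is a zero of its derivative, which is a nonzero
    polynomial of smaller degree unless [Q] is constant. *)
Lemma ae_horner_neq0 (Q : {poly R}) : Q != 0 -> {ae mu, forall t, Q.[t] != 0}.
Proof.
elim: (size Q).+1 {-2}Q (ltnSn (size Q)) => [//|N IH] {}Q sQ Q0.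
have [dQ0|dQ0] := eqVneq Q^`() 0.
  have /size1_polyC QE : (size Q <= 1)%N.
    apply/leq_sizeP => -[//|i] _; have /eqP := congr1 (fun P : {poly R} => P`_i) dQ0.
    by rewrite coef_deriv coef0 mulrn_eq0 => /eqP.
  apply: aeW => t; rewrite QE hornerC.
  by apply: contraNneq Q0 => c0; rewrite QE c0.
have := IH _ (leq_trans (lt_size_deriv Q0) sQ) dQ0.
apply: (ae_imply2 _ _ _ _ (ae_deriv_zero setT (horner Q))) => t dz.
by apply: contraNneq => Qt; apply/eqP/(dz Logic.I Qt)/has_der_horner.
Qed.

Lemma left_kernel_neq0 (k : nat) (A : 'M[R]_(k.+1, k)) :
  exists2 c : 'rV[R]_k.+1, c != 0 & forall j, \sum_i c 0 i * A i j = 0.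
Proof.
have : kermx A != 0.
  by rewrite kermx_eq0 /row_free neq_ltn ltnS rank_leq_col.
move=> kA; exists (nz_row (kermx A)); first by rewrite nz_row_eq0.
move=> j; have /sub_kermxP/matrixP/(_ 0 j) := nz_row_sub (kermx A).
by rewrite !mxE.
Qed.

Lemma derivs_vanish k (F : nat -> R -> R) c r : derivs T k F -> I c ->
  (forall j, (j < k)%N -> F j c = 0) ->
  (forall t, I t -> `|t - c| <= r -> F k t = 0) ->
  forall t, I t -> `|t - c| <= r -> F 0%N t = 0.
Proof.
move=> + Ic; elim: k F => [//|k IH] F dF Fc Fk t It tr.
apply/eqP; rewrite -(subr0 (F 0%N t)) -[X in _ - X](Fc 0%N isT) -normr_le0.
rewrite -(mul0r `|t - c|); apply: (growth_between T) => // u Iu ut.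
exists (F 1%N u); first exact: dF.
rewrite (IH (fun j => F j.+1)) ?normr0//.
- by move=> j s jk Is; exact: (dF j.+1).
- by move=> j jk; exact: Fc.
- exact: le_trans tr.
Qed.

Lemma derivs_sum k N (F : 'I_N -> nat -> R -> R) (c : 'I_N -> R) :
  (forall i, derivs T k (F i)) -> derivs T k (fun j t => \sum_(i < N) c i * F i j t).
Proof. by move=> dF j t jk It; apply: has_der_sum => i; exact: dF. Qed.

Lemma lip_sum N K (h : 'I_N -> R -> R) (c : 'I_N -> R) :
  (forall i, lip_on T K (h i)) ->
  lip_on T (\sum_(i < N) `|c i| * K) (fun t => \sum_(i < N) c i * h i t).
Proof.
move=> lh s t Is It; rewrite -sumrB mulr_suml (le_trans (ler_norm_sum _ _ _))//.
apply: ler_sum => i _; rewrite -mulrBr normrM -mulrA ler_wpM2l//.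
exact: lh.
Qed.

(** Among [n.+1] densities [w t * t ^ i] on ]p, q[, some nonzero combination is
    orthogonal to the polynomials of degree less than [n]: these are [n] linear
    conditions, expressed here by the vanishing at [T] of the iterated
    primitives from 0. Its [n]-fold primitive then lives in ]p, q[. *)
Lemma bump_exists (p q : R) (w : R -> R) : measurable_fun setT w ->
  (forall t, 0 <= w t <= 1) ->
  exists F (Q : {poly R}), exists K,
  [/\ Q != 0, derivs T n.-1 F, lip_on T K (F n.-1),
      {ae mu, forall t, I t -> has_der I (F n.-1) t (F n t)} &
      (forall t, I t -> p < t < q -> F n t = w t * Q.[t]) /\
      (forall t, I t -> ~~ (p < t < q) -> F n t = 0 /\ F 0%N t = 0)].
Proof.
move=> mw w01; pose A := (I `&` `]p, q[%classic) : set R.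
have mA : measurable A by apply: measurableI; exact: measurable_itv.
pose u (i : 'I_n.+1) t := w t * (\1_A t * t ^+ i).
have nA t : ~ A t -> \1_A t = 0 :> R by move=> nAt; rewrite indicE memNset.
have yA t : A t -> \1_A t = 1 :> R by move=> At; rewrite indicE mem_set.
have T1 : 1 <= 1 + T by rewrite lerDl ltW.
have uK i t : `|u i t| <= (1 + T) ^+ n.
  have K0 : 0 <= (1 + T) ^+ n by rewrite exprn_ge0// (le_trans ler01).
  case: (pselect (A t)) => [At|/nA At]; last by rewrite /u At mul0r mulr0 normr0.
  rewrite /u yA// mul1r normrM; have /andP[w0 w1] := w01 t.
  have [] := At; rewrite /= in_itv/= => /andP[t0 tT] _.
  rewrite (ger0_norm w0) normrX (ger0_norm t0) -[leRHS]mul1r ler_pM// ?exprn_ge0//.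
  apply: (@le_trans _ _ ((1 + T) ^+ i)).
    by rewrite lerXn2r ?nnegrE// ?(le_trans ler01)//; lra.
  by rewrite ler_weXn2l// -ltnS.
have u0 i t : ~ I t -> u i t = 0.
  by move=> nIt; rewrite /u nA ?mul0r ?mulr0// => -[].
have mu_ i : measurable_fun setT (u i).
  apply: measurable_funM => //; apply: measurable_funM; last exact: exprn_measurable.
  exact: measurable_indic.
have K0 : 0 <= (1 + T) ^+ n by rewrite exprn_ge0// (le_trans ler01).
have /choice[F HF] : forall i, exists F : nat -> R -> R,
    [/\ derivs T n.-1 F, lip_on T ((1 + T) ^+ n) (F n.-1), F n = u i,
      forall j, (j <= n.-1)%N -> F j 0 = 0 &
      {ae mu, forall t, I t -> has_der I (F n.-1) t (F n t)}].
  move=> i; have [psi [psi0 lpsi dpsi]] :=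
    bounded_primitive T _ _ (mu_ i) K0 (uK i) (u0 i).
  have [F [dF Fk Fn F0]] := antiderivative_tower T T0 n.-1 _ psi (u i) lpsi psi0.
  by rewrite prednK// in Fn; exists F; split => //; rewrite ?Fk// Fn.
have [c c0 Hc] := left_kernel_neq0 n (\matrix_(i, j) F i j T).
pose G j t := \sum_(i < n.+1) c 0 i * F i j t.
pose Q : {poly R} := \poly_(i < n.+1) c 0 (inord i).
have dG : derivs T n.-1 G by apply: derivs_sum => i; have [] := HF i.
have lG : lip_on T (\sum_(i < n.+1) `|c 0 i| * (1 + T) ^+ n) (G n.-1).
  by apply: lip_sum => i; have [] := HF i.
have aeG : {ae mu, forall t, I t -> has_der I (G n.-1) t (G n t)}.
  have : {ae mu, forall t, forall i, I t -> has_der I (F i n.-1) t (F i n t)}.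
    by apply: ae_forall_countable => i; have [] := HF i.
  by apply: ae_imply => t H It; apply: has_der_sum => i; exact: H.
have GE t : G n t = w t * (\1_A t * Q.[t]).
  rewrite /G /Q horner_poly !mulr_sumr; apply: eq_bigr => i _.
  by have [_ _ -> _ _] := HF i; rewrite /u inord_val; ring.
have Gn0 t : I t -> ~~ (p < t < q) -> G n t = 0.
  move=> It npq; rewrite GE nA ?mul0r ?mulr0// => -[_].
  by rewrite /= in_itv/=; exact/negP.
have G0 j : (j <= n.-1)%N -> G j 0 = 0.
  by move=> jn; rewrite /G big1// => i _; have [_ _ _ F0 _] := HF i; rewrite F0 ?mulr0.
have GT j : (j <= n.-1)%N -> G j T = 0.
  move=> jn; have jn' : (j < n)%N by rewrite -(prednK n0) ltnS.
  by rewrite /G -[RHS](Hc (Ordinal jn')); apply: eq_bigr => i _; rewrite mxE.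
have I0 : I 0 by rewrite /= in_itv/= lexx ltW.
have IT : I T by rewrite /= in_itv/= lexx ltW.
have acG := lip_ac T _ _ lG.
(* absolute continuity is needed here: the derivative [G n] exists only a.e. *)
have flat a b : I a -> I b -> a <= b -> (forall t, a <= t <= b -> ~~ (p < t < q)) ->
    G n.-1 a = G n.-1 b.
  move=> Ia Ib ab npq; apply/eqP; rewrite eq_sym -subr_eq0 -normr_le0.
  rewrite -(mul0r (b - a)); apply: (ac_growth_bound I) => // [t|].
    exact: (itv_sub T).
  apply: ae_imply aeG => t H abt; have It := itv_sub T _ _ _ Ia Ib abt.
  exists 0; last by rewrite normr0.
  by rewrite -[X in has_der _ _ _ X](Gn0 t It (npq t abt)); exact: H.
exists G, Q, (\sum_(i < n.+1) `|c 0 i| * (1 + T) ^+ n); split => //.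
  apply: contraNneq c0 => Q0; apply/eqP/rowP => i; rewrite mxE.
  by have := congr1 (fun P : {poly R} => P`_i) Q0; rewrite coef_poly ltn_ord inord_val coef0.
split=> [t It tpq|t It npq]; first by rewrite GE yA ?mul1r.
split; first exact: Gn0.
have /andP[t0 tT] : 0 <= t <= T by move: It; rewrite /= in_itv.
have [tp|pt] := leP t p.
  apply: (derivs_vanish n.-1 _ 0 t dG I0 (fun j jn => G0 j (ltnW jn))) => //.
    move=> s Is; rewrite subr0 ler_norml => /andP[_ st].
    have s0 : 0 <= s by move: Is; rewrite /= in_itv/= => /andP[].
    rewrite -(flat 0 s I0 Is s0) ?G0// => v /andP[_ vs].
    by rewrite negb_and -leNgt (le_trans vs (le_trans st tp)).
  by rewrite subr0 ger0_norm.
have qt : q <= t by move: npq; rewrite pt /= -leNgt.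
apply: (derivs_vanish n.-1 _ T (T - t) dG IT (fun j jn => GT j (ltnW jn))) => //.
  move=> s Is; rewrite ler_norml => /andP[st _].
  have sT : s <= T by move: Is; rewrite /= in_itv/= => /andP[].
  rewrite (flat s T Is IT sT) ?GT// => v /andP[sv _].
  rewrite negb_and -!leNgt; apply/orP; right; lra.
by rewrite distrC ger0_norm// subr_ge0.
Qed.

Variable f : R -> R.
Hypothesis ext : extreme_point (L_class n T) f.

Let Lf : L_class n T f. Proof. by case: ext. Qed.

(** A small multiple of the bump with density [w Q] is an admissible
    perturbation: [w] is the room left by the [n]-th derivative, and [eta] the
    room left by [f] where the bump lives. Extremality kills the bump, hence
    its density, and [Q] has almost no zeros. *)
Lemma extreme_local_derivn (w : R -> R) (p q eta : R) : measurable_fun setT w ->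
  (forall t, 0 <= w t <= 1) -> 0 < eta ->
  {ae mu, forall t, I t -> `|derivn_in I n f t| + w t <= 1} ->
  (forall t, I t -> p < t < q -> `|f t| <= 1 - eta) ->
  {ae mu, forall t, I t -> p < t < q -> w t = 0}.
Proof.
move=> mw w01 eta0 wf feta.
have [F [Q [K [Q0 dF lF aeF [Fin Fout]]]]] := bump_exists p q w mw w01.
have [C _ lF0] := derivs_lip T T0 _ _ _ dF lF 0%N isT.
have [B B0 HB] := lip_bounded T T0 _ _ lF0.
have [C' _ lQ] := lip_horner T T0 Q; have [D D0 HD] := lip_bounded T T0 _ _ lQ.
have B1 : 0 < B + 1 by rewrite ltr_wpDl.
have D1 : 0 < D + 1 by rewrite ltr_wpDl.
pose e := Num.min (eta / (B + 1)) (D + 1)^-1.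
have e0 : 0 < e by rewrite lt_min divr_gt0// invr_gt0.
have eB t : I t -> e * `|F 0%N t| <= eta.
  move=> It; apply: (@le_trans _ _ (eta / (B + 1) * (B + 1))); last by rewrite divfK ?gt_eqF.
  rewrite ler_pM ?(ltW e0)//; first by rewrite ge_min lexx.
  by rewrite (le_trans (HB t It))// lerDl.
have eD t : I t -> e * `|Q.[t]| <= 1.
  move=> It; apply: (@le_trans _ _ ((D + 1)^-1 * (D + 1))); last by rewrite mulVf ?gt_eqF.
  rewrite ler_pM ?(ltW e0)//; first by rewrite ge_min lexx orbT.
  by rewrite (le_trans (HD t It))// lerDl.
have F0 : forall t, I t -> F 0%N t = 0.
  have dZ : derivs T n.-1 (fun _ _ => 0 : R) by move=> j t _ _; exact: has_der_cst.
  have lZ : lip_on T 0 (fun=> 0 : R) by move=> s t _ _; rewrite subrr normr0 mul0r.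
  have := @extreme_no_perturbation _ T n T0 n0 f (fun j t => 0 + e * F j t) (0 + `|e| * K) ext
     (derivs_lin T _ _ _ e dZ dF) (lip_on_lin T _ _ _ _ e lZ lF).
  move=> H t It; have : 0 + e * F 0%N t = 0.
    apply: H It => {t} [t It|].
      rewrite add0r normrM (gtr0_norm e0).
      case: (boolP (p < t < q)) => tpq.
        by have := feta t It tpq; have := eB t It; lra.
      by have [_ ->] := Fout t It tpq; rewrite normr0 mulr0 addr0 (L_class_le1 T n f Lf).
    apply: ae_imply2 wf aeF => t wt dFt It; split.
      by apply: has_der_lin; [exact: has_der_cst|exact: dFt].
    have := wt It; rewrite add0r normrM (gtr0_norm e0).
    have /andP[w0 w1] := w01 t.
    case: (boolP (p < t < q)) => tpq; last first.
      by have [-> _] := Fout t It tpq; rewrite normr0 mulr0; lra.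
    rewrite Fin// normrM (ger0_norm w0) mulrCA.
    have := ler_wpM2l w0 (eD t It); rewrite mulr1; lra.
  by move/eqP; rewrite add0r mulf_eq0 gt_eqF//= => /eqP.
have Fn0 : {ae mu, forall t, I t -> F n t = 0}.
  apply: (derivs_ae_zero T n _ I dF aeF) => //.
  by apply: aeW => t [].
apply: ae_imply2 Fn0 (ae_horner_neq0 Q Q0) => t Ft Qt It tpq.
have := Ft It; rewrite Fin// => /eqP; rewrite mulf_eq0 (negPf Qt) orbF => /eqP //.
Qed.

(** The weight is a measurable version [w] of [1 - |f^(n)|]. Each point off the
    contact set has a neighbourhood on which [|f|] stays away from [1], and
    countably many intervals with rational endpoints provide them all. *)
Lemma extreme_derivn : {ae mu, forall t, (I `\` contact_set T f) t ->
  `|derivn_in I n f t| = 1}.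
Proof.
have [D mD HD] := lip_deriv_measurable T T0 1 _ (L_class_lip T n n0 f Lf).
pose w t := Num.max 0 (1 - `|D t|).
have mw : measurable_fun setT w.
  apply: measurable_maxr; first exact: measurable_cst.
  apply: measurable_funB; first exact: measurable_cst.
  exact: measurableT_comp.
have w01 t : 0 <= w t <= 1.
  by rewrite le_max lexx /= ge_max ler01 lerBlDr lerDl normr_ge0.
have wE : {ae mu, forall t, I t -> `|derivn_in I n f t| + w t = 1}.
  have nT : {ae mu, forall t, ~ [set T] t}.
    by apply: ae_subsingleton => s t -> ->.
  apply: ae_imply2 (L_class_ae T n n0 f Lf) nT => t H tT It; have [dt t1] := H It.
  have tT' : t < T.
    move: It; rewrite /= in_itv/= => /andP[_]; rewrite le_eqVlt => /orP[/eqP|//].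
    by move=> /tT.
  by rewrite /w (HD t _ It tT' dt) max_r; lra.
have wf : {ae mu, forall t, I t -> `|derivn_in I n f t| + w t <= 1}.
  by apply: ae_imply wE => t H It; rewrite H.
have loc : {ae mu, forall t, forall x : rat * rat * nat,
    (forall s, I s -> ratr x.1.1 < s < ratr x.1.2 -> `|f s| <= 1 - x.2.+1%:R^-1) ->
    I t -> ratr x.1.1 < t < ratr x.1.2 -> w t = 0}.
  apply: ae_forall_countable => -[[p q] k] /=.
  case: (pselect (forall s, I s -> ratr p < s < ratr q -> `|f s| <= 1 - k.+1%:R^-1)).
    move=> fk; have k0 : 0 < k.+1%:R^-1 :> R by rewrite invr_gt0.
    by apply: ae_imply (extreme_local_derivn w _ _ _ mw w01 k0 wf fk).
  by move=> nf; apply: aeW => t /nf.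
apply: ae_imply2 wE loc => t wt H [It nF].
suff w0 : w t = 0 by have := wt It; rewrite w0 addr0.
have [||e e0 [d d0 He]] := noncontact_local T n f T0 n0 Lf (fun=> 1) 1 t It _ ler01 _.
- by apply/eqP => ft; apply: nF.
- by move=> s _; rewrite normr1.
have [k _ /(_ k (leqnn k)) /= ke] := near_infty_natSinv_lt (PosNum e0).
have [p] : exists q, ratr q \in `]t - d, t[ by apply: rat_in_itvoo; rewrite ltrBlDr ltrDl.
rewrite in_itv/= => /andP[p1 p2].
have [q] : exists q, ratr q \in `]t, t + d[ by apply: rat_in_itvoo; rewrite ltrDl.
rewrite in_itv/= => /andP[q1 q2].
apply: (H (p, q, k)) => //=; last by rewrite p2.
move=> s Is /andP[ps sq]; have := He s Is.
rewrite normr1 mulr1 ltr_distl => /(_ ltac:(apply/andP; split; lra)) h.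
by rewrite lerBrDl -lerBrDr (le_trans (ltW ke)).
Qed.

End Bump.

(** * The characterization of extreme points *)

Theorem proposition1 (R : realType) (n : nat) (T : R) (f : R -> R)
    (hn : (2 <= n)%N) (hT : 0 < T) (hf : L_class n T f) :
  extreme_point (L_class n T) f <->
  (n%:R%:E <= sum_multiplicities n T f)%E /\
  {ae lebesgue_measure, forall t : R,
     (`[0, T]%classic `\` contact_set T f) t ->
     derivable_in `[0, T] (derivn_in `[0, T] n.-1 f) t /\
     `|derivn_in `[0, T] n f t| = 1}.
Proof.
have n0 : (0 < n)%N by exact: ltnW.
split=> [ext|[fsum fae]].
  split; first exact: extreme_sum_multiplicities.
  apply: ae_imply2 (L_class_ae T n n0 f hf) (extreme_derivn T n hT n0 f ext).
  move=> t H ft It; split; last exact: ft.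
  by have [dt _] := H It.1; exact: has_der_derivable_in dt.
apply: extreme_of_contacts => //.
by apply: ae_imply fae => t H /H[].
Qed.
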